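(* Let $\mathtt Z$ be a set with $|\mathtt Z|=21$. For $\sigma=1,\dots,10$, let $r(\sigma)$ be the number of $\mathfrak S_{21}$-equivalence classes of codes $\mathtt C\subset\mathrm{Pow}(\mathtt Z)$ with $\dim_{\mathbb F_2}\mathtt C=11-\sigma$ satisfying (b) the word $\mathtt Z$ is contained in $\mathtt C$, and (c) $|A|\in\{0,5,8,9,12,13,16,21\}$ for every word $A\in\mathtt C$. Then $$r(1)=1,\ r(2)=3,\ r(3)=13,\ r(4)=41,\ r(5)=58,\ r(6)=43,\ r(7)=21,\ r(8)=8,\ r(9)=3,\ r(10)=1.$$
   Context: $\mathrm{Pow}(\mathtt Z)$ is the power set of $\mathtt Z$, an $\mathbb F_2$-vector space under symmetric difference $A+B=(A\cup B)\setminus(A\cap B)$. Its elements are called words and a code is an $\mathbb F_2$-linear subspace. Two codes $\mathtt C,\mathtt C'\subset\mathrm{Pow}(\mathtt Z)$ are $\mathfrak S_{21}$-equivalent if there is a permutation $\tau$ of $\mathtt Z$ with $\tau(\mathtt C)=\mathtt C'$. *)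

(* Defs.v *)
From HB Require Import structures.
From mathcomp Require Import all_boot all_order all_algebra all_fingroup.

Set Implicit Arguments.
Unset Strict Implicit.
Unset Printing Implicit Defensive.

Import GRing.Theory.
Local Open Scope ring_scope.

(* An alias of [{set Z}], so that the 'F_2-structure below does not leak onto
   every type of finite sets.                                                 *)
Definition Pow (Z : finType) : Type := {set Z}.

HB.instance Definition _ (Z : finType) := Finite.copy (Pow Z) {set Z}.

Section PowVector.
Variable Z : finType.
Implicit Types (A B C : Pow Z) (a b : 'F_2) (x : Z).

Definition symdiff A B : Pow Z := (A :|: B) :\: (A :&: B).

Lemma in_symdiff A B x : (x \in symdiff A B) = (x \in A) (+) (x \in B).
Proof. by rewrite !inE; case: (x \in A); case: (x \in B). Qed.

Fact symdiffA : associative symdiff.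
Proof. by move=> A B C; apply/setP=> x; rewrite !in_symdiff addbA. Qed.

Fact symdiffC : commutative symdiff.
Proof. by move=> A B; apply/setP=> x; rewrite !in_symdiff addbC. Qed.

Fact symdiff0 : left_id (set0 : Pow Z) symdiff.
Proof. by move=> A; apply/setP=> x; rewrite in_symdiff inE. Qed.

Fact symdiffN : left_inverse (set0 : Pow Z) id symdiff.
Proof. by move=> A; apply/setP=> x; rewrite in_symdiff addbb inE. Qed.

HB.instance Definition _ :=
  GRing.isZmodule.Build (Pow Z) symdiffA symdiffC symdiff0 symdiffN.

Definition pow_scale a A : Pow Z := if a == 0 then set0 else A.

Lemma in_pow_scale a A x : (x \in pow_scale a A) = (a != 0) && (x \in A).
Proof. by rewrite /pow_scale; case: eqP; rewrite ?inE. Qed.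

Fact pow_scaleA a b A : pow_scale a (pow_scale b A) = pow_scale (a * b) A.
Proof. by apply/setP=> x; rewrite !in_pow_scale mulf_eq0 negb_or andbA. Qed.

Fact pow_scale1 : left_id 1 pow_scale.
Proof. by []. Qed.

Fact pow_scaleDr : right_distributive pow_scale +%R.
Proof.
by move=> a A B; apply/setP=> x; rewrite !(in_symdiff, in_pow_scale); case: eqP.
Qed.

Lemma F2_add_neq0 a b : (a + b != 0) = (a != 0) (+) (b != 0).
Proof. by case: a b => [[|[|//]] ?] [[|[|//]] ?]. Qed.

Fact pow_scaleDl A : {morph pow_scale^~ A : a b / a + b}.
Proof.
move=> a b; apply/setP=> x; rewrite !(in_symdiff, in_pow_scale) F2_add_neq0.
by case: (x \in A); rewrite ?andbT ?andbF.
Qed.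

HB.instance Definition _ := GRing.Zmodule_isLmodule.Build 'F_2 (Pow Z)
  pow_scaleA pow_scale1 pow_scaleDr pow_scaleDl.

Definition char_row (A : Pow Z) : 'rV['F_2]_#|Z| :=
  \row_i (enum_val i \in A)%:R.

Fact char_row_linear : linear char_row.
Proof.
move=> a A B; apply/rowP=> i; rewrite !mxE in_symdiff in_pow_scale.
by case: a => [[|[|//]] ?]; case: (_ \in A); case: (_ \in B); apply: val_inj.
Qed.

Fact char_row_bij : bijective char_row.
Proof.
exists (fun v : 'rV['F_2]_#|Z| => [set x | v 0 (enum_rank x) != 0]).
  by move=> A; apply/setP=> x; rewrite inE mxE enum_rankK; case: (x \in A).
move=> v; apply/rowP=> i; rewrite mxE inE enum_valK.
by case: (v 0 i) => [[|[|//]] ?]; apply: val_inj.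
Qed.

HB.instance Definition _ := Lmodule_hasFinDim.Build 'F_2 (Pow Z)
  (exist2 _ _ char_row char_row_linear char_row_bij).

End PowVector.

HB.instance Definition _ (Z : finType) : isCountable {vspace Pow Z} :=
  CanIsCountable (@VectorInternalTheory.vs2mxK _ (Pow Z)).
HB.instance Definition _ (Z : finType) : isFinite {vspace Pow Z} :=
  CanIsFinite (@VectorInternalTheory.vs2mxK _ (Pow Z)).

Section Codes.
Variable Z : finType.
Implicit Types (C : {vspace Pow Z}).

Definition perm_word (tau : {perm Z}) (A : Pow Z) : Pow Z := tau @: A.

Definition code_equiv : rel {vspace Pow Z} := fun C C' =>
  [exists tau : {perm Z}, [set perm_word tau A | A in C] == [set A in C']].

Lemma code_equiv_is_equivalence : equivalence_rel code_equiv.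
Proof.
have word1 A : perm_word 1 A = A.
  by apply/setP=> x; rewrite -{1}(perm1 x) mem_imset //; apply: perm_inj.
have wordM s t A : perm_word (s * t)%g A = perm_word t (perm_word s A).
  rewrite /perm_word -imset_comp; apply: eq_imset => x /=; exact: permM.
have refl C : code_equiv C C.
  apply/existsP; exists 1%g; apply/eqP/setP=> A; rewrite inE.
  apply/imsetP/idP => [[B BC ->]|AC]; first by rewrite word1.
  by exists A; rewrite ?word1.
have trans : transitive code_equiv.
  move=> C2 C1 C3 /existsP[s /eqP es] /existsP[t /eqP et].
  apply/existsP; exists (s * t)%g; rewrite -et; apply/eqP/setP=> A.
  apply/imsetP/imsetP => [[B BC ->]|[B BC ->]].
    exists (perm_word s B); last exact: wordM.
    have := imset_f (perm_word s) BC.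
    by rewrite es inE.
  have : B \in [set A in C2] by rewrite inE.
  by rewrite -es => /imsetP[D DC ->]; exists D; rewrite ?wordM.
have sym C1 C2 : code_equiv C1 C2 -> code_equiv C2 C1.
  case/existsP=> [s /eqP es]; apply/existsP; exists s^-1%g.
  apply/eqP/setP=> A; rewrite inE; apply/imsetP/idP => [[B]|AC].
    have -> : (B \in C2) = (B \in [set A in C2]) by rewrite inE.
    by rewrite -es => /imsetP[D DC ->] ->; rewrite -wordM mulgV word1.
  exists (perm_word s A); last by rewrite -wordM mulgV word1.
  have := imset_f (perm_word s) AC.
  by rewrite es inE.
move=> C1 C2 C3; split=> // e12; apply/idP/idP; apply: trans => //.
exact: sym.
Qed.

Definition admissible_weights : seq nat := [:: 0; 5; 8; 9; 12; 13; 16; 21]%N.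

Definition admissible_codes (sigma : nat) : {set {vspace Pow Z}} :=
  [set C | [&& \dim C == (11 - sigma)%N,
               ([set: Z] : Pow Z) \in C &
               [forall A : Pow Z, (A \in C) ==>
                  (#|(A : {set Z})| \in admissible_weights)]]].

Definition r (sigma : nat) : nat :=
  #|equivalence_partition code_equiv (admissible_codes sigma)|.

End Codes.

(* Main.v *)
Require Import Defs.
From mathcomp Require Import all_boot all_algebra all_fingroup finfield.
From Stdlib Require Import BinNat.

Set Implicit Arguments.
Unset Strict Implicit.
Unset Printing Implicit Defensive.

Import GRing.Theory.

(** Since 21 is odd, a code C containing Z is the direct sum of the line spanned by Z
    and of its subcode E of words of even weight, and condition (c) says exactly that
    the nonzero words of E have weight 8, 12 or 16.  So the task is to classify these
    doubly even codes E of length 21 in each dimension k = 10 - sigma.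

    A basis of E is a generator matrix, and E is determined up to equivalence by the
    multiset of the 21 columns of this matrix, a multiset of vectors of F_2^k.
    Equivalent codes are those whose multisets agree after a change of basis.

    Every E of dimension k + 1 arises from one of dimension k by shortening: choose a
    coordinate z and put H = {A in E : z notin A}, so that E = H + <v> for any word v of
    E through z.  Up to permutations of equal columns of H, the word v is described by
    the number j_x of ones that it has among the m_x coordinates with column x.  Three
    remarks keep the list of candidates short.  Choosing z so that its column in E has
    the largest multiplicity mu among the nonzero columns gives j_0 = mu, j_x <= mu and
    m_x - j_x <= mu.  Adding a word of H to v makes v sparse on the unit columns
    (balanceP).  As all weights in E are multiples of 4, v is orthogonal to E
    (even_meet), a system of parity conditions that is solved by a search without dead
    ends (completions).  The lemma extension_complete says that nothing is missed.

    The tables list representatives for k = 0, ..., 9.  For every candidate extension of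
    a representative that has the right weights, a stored change of basis identifies it
    with an entry of the next table (tables_closed); by induction on k this shows that
    the tables meet all classes (classification).  The entries of one table are pairwise
    inequivalent because an equivalence induces a linear isomorphism of the codes that
    preserves weights, and counts defined by weights and addition alone separate them
    (tables_irredundant): mostly the number of words at distance 8 from a given word
    among the words of weight 8, and for one pair of two-weight codes of dimension 6 the
    number of cliques in the graph formed by these words. *)

(** * Bit sequences *)

Fixpoint dot (a x : bitseq) : bool :=
  match a, x with
  | b :: a', c :: x' => (b && c) (+) dot a' x'
  | _, _ => false
  end.

Fixpoint addw (a b : bitseq) : bitseq :=
  match a, b with
  | x :: a', y :: b' => (x (+) y) :: addw a' b'
  | _, _ => [::]
  end.

Fixpoint bits k : seq bitseq :=
  if k is k'.+1 then map (cons false) (bits k') ++ map (cons true) (bits k')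
  else [:: [::]].

Definition zerow k : bitseq := nseq k false.

Definition unitw k i : bitseq := mkseq (eq_op^~ i) k.

Lemma mem_bits k a : (a \in bits k) = (size a == k).
Proof.
have mem_cons b c (s : seq bitseq) x : (b :: x \in map (cons c) s) = (b == c) && (x \in s).
  apply/mapP/andP=> [[y sy [-> ->]]|[/eqP-> sx]]; first by rewrite eqxx.
  by exists x.
elim: k a => [|k IHk] [|b a] //=; rewrite mem_cat.
  by apply/negbTE/norP; split; apply/mapP=> -[].
by rewrite !mem_cons IHk -andb_orl; case: b.
Qed.

Lemma uniq_bits k : uniq (bits k).
Proof.
elim: k => //= k IHk; rewrite cat_uniq !map_inj_uniq ?IHk; try by move=> ? ? [].
by rewrite andbT; apply/hasPn=> _ /mapP[a _ ->]; apply/mapP=> -[].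
Qed.

Lemma size_bits k : size (bits k) = 2 ^ k.
Proof. by elim: k => //= k IHk; rewrite size_cat !size_map IHk addnn expnS mul2n. Qed.

Lemma size_addw a b : size a = size b -> size (addw a b) = size a.
Proof. by elim: a b => [|x a IHa] [|y b] //= [/IHa->]. Qed.

Lemma dotC a x : dot a x = dot x a.
Proof. by elim: a x => [|b a IHa] [|c x] //=; rewrite IHa andbC. Qed.

Lemma dot_addl a b x : size a = size b -> dot (addw a b) x = dot a x (+) dot b x.
Proof.
elim: a b x => [|u a IHa] [|v b] [|w x] //= [/IHa->].
by rewrite andb_addl !addbA; congr (_ (+) _); rewrite addbAC.
Qed.

Lemma dot_addr a x y : size x = size y -> dot a (addw x y) = dot a x (+) dot a y.
Proof. by move=> /dot_addl e; rewrite dotC e !(dotC _ a). Qed.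

Lemma dot0l k x : dot (zerow k) x = false.
Proof. by elim: k x => [|k IHk] [|b x] //=. Qed.

Lemma dot_unitl k i x : size x = k -> dot (unitw k i) x = nth false x i.
Proof.
rewrite /unitw /mkseq; move=> <- {k}.
elim: x i => [|b x IHx] i /=; first by rewrite nth_nil.
have shift m n : [seq (j == m.+1) | j <- iota n.+1 (size x)] =
                 [seq (j == m) | j <- iota n (size x)].
  by rewrite (iotaDl 1 n) -map_comp; apply: eq_map => j.
case: i => [|i] /=; last by rewrite shift IHx.
rewrite [X in _ (+) X](_ : _ = false) ?addbF //.
rewrite -[RHS](dot0l (size x) x); congr (dot _ x).
rewrite /zerow -{2}(size_iota 0 (size x)) (iotaDl 1 0) -map_comp.
by elim: (iota 0 _) => //= j s ->.
Qed.

Lemma addww k a : size a = k -> addw a a = zerow k.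
Proof. by move=> <-; elim: a => //= b a ->; rewrite addbb. Qed.

Lemma addwK k a b : size a = k -> size b = k -> addw (addw a b) b = a.
Proof.
move=> <-; elim: a b => [|x a IHa] [|y b] //= [/IHa->].
by rewrite -addbA addbb addbF.
Qed.

Lemma dot_nondegenerate k x : size x = k -> (forall a, size a = k -> dot a x = false) -> x = zerow k.
Proof.
move=> sx x0; apply: (@eq_from_nth _ false) => [|i _]; first by rewrite size_nseq.
by rewrite -(@dot_unitl k) // x0 ?size_mkseq // nth_nseq if_same.
Qed.

(** * Tries *)

(** Binary tries indexed by F_2^k, so that a function on F_2^k is evaluated once per
    argument. *)
Inductive tree T := Leaf of T | Node of tree T & tree T.

Fixpoint tabulate T k (f : bitseq -> T) : tree T :=
  if k is k'.+1 then
    Node (tabulate k' (f \o cons false)) (tabulate k' (f \o cons true))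
  else Leaf (f [::]).

Fixpoint lookup T (t : tree T) (a : bitseq) : T :=
  match t with
  | Leaf v => v
  | Node l r => if a is b :: a' then lookup (if b then r else l) a'
                else lookup l [::]
  end.

Lemma lookup_tabulate T k (f : bitseq -> T) a :
  size a = k -> lookup (tabulate k f) a = f a.
Proof. by elim: k f a => [|k IHk] f [|b a] //= [/IHk IH]; case: b; rewrite IH. Qed.

(** * Codes as column functions *)

Section Columns.
Variable Z : finType.
Implicit Types (c : Z -> bitseq) (E : {vspace Pow Z}) (A B : Pow Z).

Local Notation card A := #|(A : {set Z})|.

(** If c y is the column of a generator matrix at the coordinate y, this is the codeword
    given by the combination a of its rows. *)
Definition word c (a : bitseq) : Pow Z := [set y | dot a (c y)].

(** The rows of the matrix with columns c span E; they may be dependent. *)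
Definition codes k c E :=
  (forall y, size (c y) = k) /\ (forall A, A \in E = (A \in map (word c) (bits k))).

Lemma in_word c a y : (y \in (word c a : {set Z})) = dot a (c y).
Proof. by rewrite inE. Qed.

Lemma in_add A B y :
  (y \in ((A + B)%R : {set Z})) = (y \in (A : {set Z})) (+) (y \in (B : {set Z})).
Proof. exact: in_symdiff. Qed.

Lemma in_zero y : (y \in ((0 : Pow Z)%R : {set Z})) = false.
Proof. exact: in_set0. Qed.

Lemma word_add c a b : size a = size b -> word c (addw a b) = (word c a + word c b)%R.
Proof. by move=> sab; apply/setP=> y; rewrite in_add !in_word dot_addl. Qed.

Lemma word_zero c k : word c (zerow k) = 0%R.
Proof. by apply/setP=> y; rewrite in_word dot0l in_zero. Qed.

Lemma addPP A : (A + A = 0)%R.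
Proof. by apply/setP=> y; rewrite in_add addbb in_zero. Qed.

Lemma card_sub_codom c (P : pred bitseq) : #|[set y | P (c y)]| = count P (codom c).
Proof.
rewrite cardsE cardE /codom /image_mem count_map /enum_mem size_filter.
by rewrite (@eq_filter _ (mem predT) predT) // filter_predT.
Qed.

Lemma card_word c a : card (word c a) = count (dot a) (codom c).
Proof. exact: (card_sub_codom c (dot a)). Qed.

Lemma scalePE (r : 'F_2) A : (r *: A = if r == 0 then 0 else A)%R.
Proof. by []. Qed.

(** In characteristic two closure under addition is enough for a subspace. *)
Lemma memv_span_closed (s : seq (Pow Z)) :
  0%R \in s -> {in s &, forall A B, (A + B)%R \in s} -> <<s>>%VS =i s.
Proof.
move=> s0 sD A; apply/idP/idP; last exact: memv_span.
rewrite -[s]/(tval (in_tuple s)) => /coord_span->.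
apply: (big_ind (fun A => A \in s)) => [||i _]; [by []|by move=> A1 A2; apply: sD|];
  rewrite scalePE; case: ifP => // _.
by apply: mem_nth; rewrite ltn_ord.
Qed.

(** The span of all the combinations of rows rather than of the rows, since the set of
    these combinations is already closed under addition. *)
Definition code k c : {vspace Pow Z} := <<map (word c) (bits k)>>%VS.

Lemma codes_code k c : (forall y, size (c y) = k) -> codes k c (code k c).
Proof.
move=> sc; split=> // A; apply: memv_span_closed.
  by rewrite -(word_zero c k) map_f // mem_bits size_nseq.
move=> _ _ /mapP[a aP ->] /mapP[b bP ->]; move: aP bP; rewrite !mem_bits => /eqP sa /eqP sb.
by rewrite -word_add ?sa ?sb // map_f // mem_bits size_addw ?sa ?sb.
Qed.

Lemma card_code E : #|E| = 2 ^ \dim E.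
Proof. by rewrite (@card_vspace 'F_2 (Pow Z)) card_Fp. Qed.

Lemma word_inj k c : (forall y, size (c y) = k) ->
  (forall a, size a = k -> a != zerow k -> word c a != 0%R) -> {in bits k &, injective (word c)}.
Proof.
move=> sc c0 a b; rewrite !mem_bits => /eqP sa /eqP sb eq_ab.
have sab : size (addw a b) = k by rewrite size_addw ?sa ?sb.
apply/eqP/idPn=> neq_ab.
have := c0 _ sab; rewrite word_add ?sa ?sb // eq_ab addPP eqxx => /(_ _)/negP; apply=> //.
by apply: contra neq_ab => /eqP ab0; rewrite -(addwK sa sb) ab0 -{1}(addww sb) (addwK sb sb).
Qed.

Lemma codes_dim k c E : codes k c E -> {in bits k &, injective (word c)} -> \dim E = k.
Proof.
case=> sc Ec cI; apply/eqP; rewrite -(@eqn_exp2l 2) // -card_code -size_bits.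
rewrite -(size_map (word c)) (eq_card Ec) (card_uniqP _) //.
by rewrite map_inj_in_uniq ?uniq_bits.
Qed.

Lemma codes_subset k c E : (forall y, size (c y) = k) ->
    {in bits k, forall a, word c a \in E} -> \dim E = k ->
    {in bits k &, injective (word c)} -> codes k c E.
Proof.
move=> sc cE dE cI; split=> // A; apply/esym; move: A.
have sub : {subset map (word c) (bits k) <= E} by move=> _ /mapP[a ak ->]; apply: cE.
apply: (@subset_cardP _ (mem (map (word c) (bits k))) (mem E)); last exact/subsetP.
by rewrite card_code dE (card_uniqP _) ?size_map ?size_bits // map_inj_in_uniq ?uniq_bits.
Qed.
End Columns.

(** * Search for extensions *)

(** The weight of a codeword only depends on the multiset of columns. *)
Definition weight (s : seq bitseq) (a : bitseq) : nat := count (dot a) s.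

Definition good_weight (w : nat) : bool := w \in [:: 8; 12; 16].

Definition tallied (s : seq bitseq) : seq (bitseq * nat) :=
  [seq (x, count_mem x s) | x <- undup s].

(** The vector s + j x over F_2. *)
Definition add_copies (j : nat) (x s : bitseq) : bitseq := if odd j then addw x s else s.

(** An entry (x, js) of L offers a choice of a multiplicity j in js for the vector x.
    The function returned maps s to the lists of choices whose sum with s is 0; the trie
    returned with it tells for which s there is one, which prunes every branch of the
    enumeration that cannot be completed. *)
Fixpoint completions (k : nat) (L : seq (bitseq * seq nat)) :
    tree bool * (bitseq -> seq (seq nat)) :=
  match L with
  | [::] => (tabulate k (pred1 (zerow k)), fun=> [:: [::]])
  | (x, js) :: L' =>
    let: (t, f) := completions k L' in
    (tabulate k (fun s => has (fun j => lookup t (add_copies j x s)) js),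
     fun s => flatten [seq (let s' := add_copies j x s in
                 if lookup t s' then map (cons j) (f s') else [::]) | j <- js])
  end.

(** The possible numbers j of ones of v among the m coordinates with column x, when the
    coordinate z of column 0 is one of mu twins in E and no nonzero column of E occurs
    more than mu times. On a unit column v may be assumed to have at most as many ones
    as zeros. *)
Definition split_options k (mu : nat) (p : bitseq * nat) : seq nat :=
  let: (x, m) := p in
  if x == zerow k then [:: mu] else
  [seq j <- iota 0 m.+1 |
     [&& j <= mu, m - j <= mu & (x \in mkseq (unitw k) k) ==> (j <= m - j)]].

(** The bit true in front of x makes the sum to be 0 record the parity of the weight of
    v as well as the parities of its intersections with the words of H. *)
Definition admissible_splits k (R : seq (bitseq * nat)) (mu : nat) : seq (seq nat) :=
  (completions k.+1 [seq (true :: p.1, split_options k mu p) | p <- R]).2 (zerow k.+1).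

(** The columns of H + <v>: the new row v is put first, so that its value at a
    coordinate is consed to the column. *)
Definition split_columns (R : seq (bitseq * nat)) (js : seq nat) : seq bitseq :=
  flatten [seq nseq q.2 (true :: q.1.1) ++ nseq (q.1.2 - q.2) (false :: q.1.1)
             | q <- zip R js].

(** Only the words outside H have to be tested for their weight. *)
Definition extensions k (s : seq bitseq) : seq (seq bitseq) :=
  let R := tallied s in
  [seq K <- [seq split_columns R js |
               js <- flatten [seq admissible_splits k R mu |
                                mu <- iota 1 (count_mem (zerow k) s)]] |
     all (fun a => good_weight (weight K (true :: a))) (bits k)].

Lemma size_add_copies k j x s : size x = k -> size s = k -> size (add_copies j x s) = k.
Proof. by move=> sx ss; rewrite /add_copies; case: ifP => // _; rewrite size_addw ?sx. Qed.

Lemma completions_complete k (J : bitseq -> nat) (L : seq (bitseq * seq nat)) s :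
    size s = k -> (forall p, p \in L -> size p.1 = k /\ J p.1 \in p.2) ->
    foldl (fun t p => add_copies (J p.1) p.1 t) s L = zerow k ->
  lookup (completions k L).1 s && ([seq J p.1 | p <- L] \in (completions k L).2 s).
Proof.
elim: L s => [|[x js] L IHL] s ss Lok /=.
  by move=> ->; rewrite lookup_tabulate ?size_nseq ?mem_head //= eqxx.
have [/= sx Jx] := Lok _ (mem_head _ _).
move/IHL; rewrite (@size_add_copies k) // => /(_ erefl) {IHL}.
case: (completions k L) => t f /= IHL.
have /IHL/andP[tJ fJ] : forall p, p \in L -> size p.1 = k /\ J p.1 \in p.2.
  by move=> p Lp; apply: Lok; rewrite inE Lp orbT.
rewrite lookup_tabulate //; apply/andP; split; first by apply/hasP; exists (J x).
by apply/flatten_mapP; exists (J x) => //=; rewrite tJ map_f.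
Qed.

Lemma dot_sum_copies k a (J : bitseq -> nat) (L : seq (bitseq * seq nat)) s :
    size s = k -> (forall p, p \in L -> size p.1 = k) ->
  dot a (foldl (fun t p => add_copies (J p.1) p.1 t) s L) =
  dot a s (+) odd (\sum_(p <- L) J p.1 * dot a p.1).
Proof.
elim: L s => [|p L IHL] s ss Lok /=; first by rewrite big_nil addbF.
have sp : size p.1 = k by apply: Lok; rewrite mem_head.
rewrite IHL ?(@size_add_copies k) //; last by move=> q Lq; apply: Lok; rewrite inE Lq orbT.
rewrite big_cons oddD oddM addbA /add_copies; congr (_ (+) _).
by case: (odd _); rewrite ?addbF // dot_addr ?sp ?ss // addbC; case: (dot a p.1).
Qed.

Lemma size_sum_copies k (J : bitseq -> nat) (L : seq (bitseq * seq nat)) s :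
    size s = k -> (forall p, p \in L -> size p.1 = k) ->
  size (foldl (fun t p => add_copies (J p.1) p.1 t) s L) = k.
Proof.
elim: L s => [|p L IHL] s ss Lok //=; apply: IHL => [|q Lq].
  by rewrite (@size_add_copies k) // Lok // mem_head.
by apply: Lok; rewrite inE Lq orbT.
Qed.

Lemma split_columnsE (R : seq (bitseq * nat)) (J : bitseq -> nat) :
  split_columns R [seq J p.1 | p <- R] =
  flatten [seq nseq (J p.1) (true :: p.1) ++ nseq (p.2 - J p.1) (false :: p.1) | p <- R].
Proof. by congr flatten; elim: R => //= p R ->. Qed.

Lemma count_split_columns P (R : seq (bitseq * nat)) (J : bitseq -> nat) :
  count P (split_columns R [seq J p.1 | p <- R]) =
  \sum_(p <- R) (J p.1 * P (true :: p.1) + (p.2 - J p.1) * P (false :: p.1)).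
Proof.
rewrite split_columnsE count_flatten sumnE !big_map; apply: eq_bigr => p _.
by rewrite count_cat !count_nseq !(mulnC (nat_of_bool _)).
Qed.

(** The entries of tallied s have distinct first components, so at most one term
    survives. *)
Lemma sum_tallied (F : bitseq -> nat -> nat) s x :
  \sum_(p <- tallied s) (p.1 == x) * F p.1 p.2 = (x \in s) * F x (count_mem x s).
Proof.
rewrite big_map -mem_undup; have [xs|xs] := boolP (x \in undup s).
  rewrite (bigD1_seq x) ?undup_uniq //= eqxx mul1n big1 ?addn0 ?mul1n //.
  by move=> y /negPf->.
rewrite big_seq big1 // => y ys /=; case: eqP => // eq_yx.
by rewrite -eq_yx ys in xs.
Qed.

Section Split.
Variable Z : finType.
Implicit Types (c : Z -> bitseq) (E : {vspace Pow Z}) (A B v : Pow Z).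
Local Notation card A := #|(A : {set Z})|.

Definition extend c v (y : Z) : bitseq := (y \in (v : {set Z})) :: c y.

(** Up to order, the columns of the extended code only depend on the number of ones of v
    among the coordinates with a given column. *)
Lemma perm_split c v s : perm_eq (codom c) s ->
  perm_eq (codom (extend c v))
   (split_columns (tallied s)
     [seq #|[set y in (v : {set Z}) | c y == p.1]| | p <- tallied s]).
Proof.
move=> cs; set J := fun x => #|[set y in (v : {set Z}) | c y == x]|.
apply/allP=> t _ /=; apply/eqP.
rewrite (count_split_columns (pred1 t) (tallied s) J) -(card_sub_codom (extend c v)).
case: t => [|b x].
  rewrite big1 => [|p _]; last by rewrite /= !muln0.
  by apply: eq_card0 => y; rewrite inE.
under eq_bigr => p _ do rewrite /= !eqseq_cons.
rewrite (eq_bigr (fun p => (p.1 == x) * (if b then J p.1 else p.2 - J p.1))); last first.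
  by move=> p _; case: b => /=; rewrite ?muln0 ?addn0 ?add0n mulnC.
rewrite (sum_tallied (fun x m => if b then J x else m - J x)) -(perm_mem cs).
have -> : (x \in codom c) * (if b then J x else count_mem x s - J x) =
          (if b then J x else count_mem x s - J x).
  have [xc|xc] := boolP (x \in codom c); first by rewrite mul1n.
  have J0 : J x = 0.
    apply: eq_card0 => y; rewrite !inE; apply/negbTE/nandP; right.
    by apply: contra xc => /eqP <-; apply: codom_f.
  by rewrite J0 -(seq.permP cs) (count_memPn xc); case: b.
have -> : count_mem x s = #|[set y | c y == x]|.
  by rewrite -(seq.permP cs) -(card_sub_codom c (pred1 x)).
rewrite -[X in X - _](cardsID (v : {set Z})).
have -> : [set y | c y == x] :&: v = [set y in (v : {set Z}) | c y == x].
  by apply/setP=> y; rewrite !inE andbC.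
rewrite addKn; case: b; apply: eq_card => y; rewrite !inE /= eqseq_cons.
  by case: (y \in _).
by case: (y \in _).
Qed.

Lemma sum_split c v s (P : pred bitseq) : perm_eq (codom c) s ->
  \sum_(p <- tallied s) #|[set y in (v : {set Z}) | c y == p.1]| * P p.1 =
  #|[set y in (v : {set Z}) | P (c y)]|.
Proof.
move=> cs; pose P' (x : bitseq) := head false x && P (behead x).
have := seq.permP (perm_split v cs) P'.
rewrite (count_split_columns P' _ (fun x => #|[set y in (v : {set Z}) | c y == x]|)).
rewrite -(card_sub_codom (extend c v)) => e.
rewrite [RHS](_ : _ = #|[set y | P' (extend c v y)]|) ?e //.
  by apply: eq_bigr => p _; rewrite /P' /= muln0 addn0.
Qed.
End Split.

Section Extension.
Variable Z : finType.
Implicit Types (c : Z -> bitseq) (E : {vspace Pow Z}) (A B v : Pow Z).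
Local Notation card A := #|(A : {set Z})|.

(** The even numbers among the admissible weights; the odd ones are their complements to
    21. *)
Definition doubly_even E := forall A, A \in E -> card A \in [:: 0; 8; 12; 16].

Lemma card_add A B :
  card (A + B)%R + (#|(A : {set Z}) :&: (B : {set Z})|).*2 = card A + card B.
Proof.
set I := (A : {set Z}) :&: (B : {set Z}).
have IU : (((A : {set Z}) :|: (B : {set Z})) :&: I) = I.
  by apply/setIidPr; rewrite subIset // subsetUl.
have leIU : #|I| <= #|(A : {set Z}) :|: (B : {set Z})|.
  by rewrite -IU subset_leq_card // subsetIl.
have -> : card (A + B)%R = #|(A : {set Z}) :|: (B : {set Z})| - #|I|.
  by rewrite -[in RHS]IU -cardsD.
by rewrite -addnn addnA subnK ?cardsUI.
Qed.

Lemma odd_card_add A B : odd (card (A + B)%R) = odd (card A) (+) odd (card B).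
Proof. by rewrite -oddD -card_add oddD odd_double addbF. Qed.

(** A linear form, given as an additive boolean function phi, cuts out a subspace of
    index 2 as soon as it is not zero on E: translation by v exchanges the two halves of
    E. *)
Lemma hyperplane E (phi : Pow Z -> bool) v :
    (forall A B, phi (A + B)%R = phi A (+) phi B) -> v \in E -> phi v ->
  exists H : {vspace Pow Z},
    \dim E = (\dim H).+1 /\ forall A, (A \in H) = (A \in E) && ~~ phi A.
Proof.
move=> phiD Ev phiv; pose s := [seq A <- enum E | ~~ phi A].
have sE A : (A \in s) = (A \in E) && ~~ phi A.
  by rewrite mem_filter mem_enum andbC.
have HE : <<s>>%VS =i s.
  apply: memv_span_closed.
    by rewrite sE mem0v -[X in phi X](addPP 0%R) phiD addbb.
  move=> A B; rewrite !sE => /andP[EA /negPf nA] /andP[EB /negPf nB].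
  by rewrite memvD // phiD nA nB.
exists <<s>>%VS; split=> [|A]; last by rewrite HE sE.
apply/eqP; rewrite -(@eqn_exp2l 2) // -card_code expnS -card_code mul2n -addnn.
rewrite -(cardID [pred A | phi A]); apply/eqP; congr (_ + _).
  rewrite -(card_imset [in <<s>>%VS] (addrI v)); apply: eq_card => A.
  apply/idP/imsetP=> [/andP[/= EA phiA]|[B HB ->]].
    exists (v + A)%R; last by rewrite addrA addPP add0r.
    by rewrite HE sE memvD // phiD phiv [phi A]phiA.
  move: HB; rewrite HE sE => /andP[EB /negPf nB].
  by rewrite !inE /= phiD phiv nB memvD.
by apply: eq_card => A; rewrite HE sE !inE andbC.
Qed.

(** Two columns agree if and only if no word of the code separates the two coordinates,
    because each bit of a column is the value of a word. *)
Lemma eq_columnP k c E y z : codes k c E ->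
  reflect (forall A, A \in E -> (y \in (A : {set Z})) = (z \in (A : {set Z}))) (c y == c z).
Proof.
case=> sc Ec; apply: (iffP eqP) => [eq_c A|eqA].
  by rewrite Ec => /mapP[a _ ->]; rewrite !in_word eq_c.
apply: (@eq_from_nth _ false) => [|i _]; first by rewrite !sc.
rewrite -!(dot_unitl _ (sc _)) -!in_word; apply: eqA.
by rewrite Ec map_f // mem_bits size_mkseq.
Qed.

(** The coordinates with the same column as z, expressed without choosing a basis. *)
Definition twins E (z : Z) : {set Z} :=
  [set y | [forall A in E, (y \in (A : {set Z})) == (z \in (A : {set Z}))]].

Lemma twinsE k c E z : codes k c E -> twins E z = [set y | c y == c z].
Proof.
move=> cE; apply/setP=> y; rewrite !inE.
by apply/'forall_in_eqP/(eq_columnP _ _ cE).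
Qed.

Lemma word_extend c v b a :
  word (extend c v) (b :: a) = ((if b then v else 0) + word c a)%R.
Proof.
by apply/setP=> y; rewrite in_add !in_word /=; case: b; rewrite ?in_zero.
Qed.

(** A word v outside the hyperplane H completes a generator matrix of H to one of E. *)
Lemma codes_extend k c E H (phi : Pow Z -> bool) v :
    codes k c H -> (forall A B, phi (A + B)%R = phi A (+) phi B) ->
    (forall A, (A \in H) = (A \in E) && ~~ phi A) -> v \in E -> phi v ->
  codes k.+1 (extend c v) E.
Proof.
move=> [sc Hc] phiD HE Ev phiv; split=> [y|A]; first by rewrite /= sc.
have aH a : a \in bits k -> word c a \in H by move=> ak; rewrite Hc map_f.
apply/idP/mapP=> [EA|[[|b a]]]; last 1 first.
- rewrite mem_bits /= eqSS -mem_bits => /aH; rewrite HE => /andP[Ea _] ->.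
  by rewrite word_extend memvD //; case: b; rewrite ?mem0v.
- have: (A + (if phi A then v else 0))%R \in H.
    rewrite HE memvD //=; last by case: ifP; rewrite ?mem0v.
    by case phiA: (phi A); rewrite ?addr0 ?phiA // phiD phiA phiv.
  rewrite Hc => /mapP[a ak eqA]; exists (phi A :: a); first by rewrite mem_bits /= eqSS -mem_bits.
  rewrite word_extend -eqA addrC -addrA; case: (phi A); rewrite ?addPP ?addr0 //.
by rewrite mem_bits.
Qed.

(** The vector that the search requires to be 0 is tested against all (b, a): for b = 0
    its product is the parity of the meet of v with the word of a, for b = 1 that of the
    rest of v. *)
Lemma mem_admissible_splits c v k s mu :
    (forall y, size (c y) = k) -> perm_eq (codom c) s ->
    (forall A, A \in map (word c) (bits k) ->
       ~~ odd #|(v : {set Z}) :&: (A : {set Z})|) -> ~~ odd (card v) ->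
    (forall p, p \in tallied s ->
       #|[set y in (v : {set Z}) | c y == p.1]| \in split_options k mu p) ->
  [seq #|[set y in (v : {set Z}) | c y == p.1]| | p <- tallied s]
    \in admissible_splits k (tallied s) mu.
Proof.
move=> sc cs orth evenv optJ; rewrite /admissible_splits.
set J := fun x => #|[set y in (v : {set Z}) | c y == x]|.
set L := [seq (true :: p.1, split_options k mu p) | p <- tallied s].
have -> : [seq J p.1 | p <- tallied s] = [seq (J \o behead) p.1 | p <- L].
  by rewrite -[RHS]map_comp; apply: eq_map.
have sL p : p \in L -> size p.1 = k.+1 /\ (J \o behead) p.1 \in p.2.
  case/mapP=> q sq -> /=; split; last exact: optJ.
  case/mapP: (sq) => x; rewrite mem_undup -(perm_mem cs) => /codomP[y ->] -> /=.
  by rewrite sc.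
have s0 : size (zerow k.+1) = k.+1 by rewrite size_nseq.
have sL1 p : p \in L -> size p.1 = k.+1 by case/sL.
suff /(completions_complete s0 sL)/andP[] : foldl
  (fun t p => add_copies ((J \o behead) p.1) p.1 t) (zerow k.+1) L = zerow k.+1 by [].
apply: dot_nondegenerate => [|a]; first exact: size_sum_copies.
case: a => [|b a] // [sa].
rewrite (@dot_sum_copies k.+1) // [dot _ (zerow _)]dotC dot0l addFb big_map.
rewrite (sum_split v (fun x => dot (b :: a) (true :: x)) cs).
have -> : [set y in (v : {set Z}) | dot (b :: a) (true :: c y)] =
          if b then (v : {set Z}) :\: word c a else (v : {set Z}) :&: word c a.
  by apply/setP=> y; case: b; rewrite !inE //= andbC.
have ov : ~~ odd #|(v : {set Z}) :&: word c a|.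
  by apply: orth; rewrite map_f // mem_bits sa.
case: b; last exact/negbTE.
by move: evenv; rewrite -(cardsID (word c a) v) oddD (negPf ov) => /negPf.
Qed.

(** The combination of rows to be added to v: row i is used when v has more ones than
    zeros on the coordinates with the i-th unit column. Row i is constant on the
    coordinates with a given unit column, equal to 1 on the i-th one and to 0 on the
    others, so the corrections do not interfere. *)
Definition balance c v k : bitseq :=
  mkseq (fun i => #|[set y | c y == unitw k i] :\: (v : {set Z})|
                    < #|[set y in (v : {set Z}) | c y == unitw k i]|) k.

Lemma balanceP k c v x : (forall y, size (c y) = k) -> x \in mkseq (unitw k) k ->
  let v' : Pow Z := (v + word c (balance c v k))%R in
  #|[set y in (v' : {set Z}) | c y == x]| <= #|[set y | c y == x] :\: (v' : {set Z})|.
Proof.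
move=> sc /mapP[i]; rewrite mem_iota /= add0n => ltik ->.
set v' := (v + _)%R; rewrite /=.
have v'E y : c y == unitw k i -> (y \in (v' : {set Z})) = (y \in (v : {set Z})) (+)
    (#|[set y | c y == unitw k i] :\: (v : {set Z})|
       < #|[set y in (v : {set Z}) | c y == unitw k i]|).
  move=> /eqP cy; rewrite in_add in_word cy dotC dot_unitl ?size_mkseq //.
  by rewrite nth_mkseq.
clearbody v'.
have [ltJ|leJ] := ltnP #|[set y | c y == unitw k i] :\: (v : {set Z})|
   #|[set y in (v : {set Z}) | c y == unitw k i]|.
  have -> : [set y in (v' : {set Z}) | c y == unitw k i] =
            [set y | c y == unitw k i] :\: (v : {set Z}).
    apply/setP=> y; rewrite !inE; have [/v'E->|] := boolP (c y == _); last by rewrite !andbF.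
    by rewrite ltJ addbT.
  have -> // : [set y | c y == unitw k i] :\: (v' : {set Z}) =
            [set y in (v : {set Z}) | c y == unitw k i].
    apply/setP=> y; rewrite !inE; have [/v'E->|] := boolP (c y == _); last by rewrite !andbF.
    by rewrite ltJ addbT negbK.
  exact: ltnW.
have -> : [set y in (v' : {set Z}) | c y == unitw k i] =
          [set y in (v : {set Z}) | c y == unitw k i].
  apply/setP=> y; rewrite !inE; have [/v'E->|] := boolP (c y == _); last by rewrite !andbF.
  by rewrite ltnNge leJ addbF.
have -> // : [set y | c y == unitw k i] :\: (v' : {set Z}) =
             [set y | c y == unitw k i] :\: (v : {set Z}).
apply/setP=> y; rewrite !inE; have [/v'E->|] := boolP (c y == _); last by rewrite !andbF.
by rewrite ltnNge leJ addbF.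
Qed.

(** |A + B| = |A| + |B| - 2 |A meet B| and the three weights are multiples of 4. *)
Lemma even_meet E A B : doubly_even E -> A \in E -> B \in E ->
  ~~ odd #|(A : {set Z}) :&: (B : {set Z})|.
Proof.
move=> dE EA EB; have := card_add A B.
have four D : D \in E -> card D = (card D %/ 4) * 4.
  by move/dE; rewrite !inE => /or4P[] /eqP->.
rewrite (four _ EA) (four _ EB) (four _ (memvD EA EB)) => e.
apply/negP=> oddI; have: odd (#|(A : {set Z}) :&: (B : {set Z})|.*2)./2.
  by rewrite doubleK.
rewrite (_ : _.*2 = (card A %/ 4 + card B %/ 4 - card (A + B)%R %/ 4) * 4).
  by rewrite (_ : 4 = 2 * 2) // mulnA muln2 doubleK muln2 odd_double.
by rewrite mulnBl mulnDl -e addKn.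
Qed.

(** Shortening at a coordinate z of largest multiplicity among the nonzero columns
    exhibits E as one of the extensions enumerated for the representative of the
    shortened code. *)
Lemma extension_complete k E (T : seq (seq bitseq)) : doubly_even E -> \dim E = k.+1 ->
    (forall H, doubly_even H -> \dim H = k -> exists2 s, s \in T &
       exists2 c : Z -> bitseq, codes k c H & perm_eq (codom c) s) ->
  exists2 s, s \in T & exists2 K, K \in extensions k s &
    exists2 c : Z -> bitseq, codes k.+1 c E & perm_eq (codom c) K.
Proof.
move=> dE dimE IH.
pose covered y := [exists A in E, y \in (A : {set Z})].
have [y0 y0P] : exists y, covered y.
  have : vpick E != 0%R by rewrite vpick0 -dimv_eq0 dimE.
  move=> /eqP nz; have [e|[y yA]] := set_0Vmem (vpick E : {set Z}); first by [].
  by exists y; apply/exists_inP; exists (vpick E); rewrite ?memv_pick.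
case: (arg_maxnP (fun y => #|twins E y|) y0P) => z /exists_inP[v0 Ev0 v0z] zmax.
pose phi A := z \in (A : {set Z}).
have phiD A B : phi (A + B)%R = phi A (+) phi B by apply: in_add.
(* H is the shortening of E at z, where the column of z becomes 0. *)
have [H [dimH HE]] := hyperplane phiD Ev0 v0z.
have dH : doubly_even H by move=> A; rewrite HE => /andP[/dE].
have dimHk : \dim H = k by apply/eqP; rewrite -eqSS -dimH dimE.
have [s Ts [c cH cs]] := IH H dH dimHk.
have [sc Hc] := cH.
pose v : Pow Z := (v0 + word c (balance c v0 k))%R.
have Hb : word c (balance c v0 k) \in H by rewrite Hc map_f // mem_bits size_mkseq.
have Ev : v \in E by rewrite memvD //; move: Hb; rewrite HE => /andP[].
have vz : phi v by rewrite phiD [phi v0]v0z; move: Hb; rewrite HE => /andP[_ /negPf->].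
have vbal x (xu : x \in mkseq (unitw k) k) :
    #|[set y in (v : {set Z}) | c y == x]| <= #|[set y | c y == x] :\: (v : {set Z})|.
  exact: balanceP.
clearbody v; have cE := codes_extend cH phiD HE Ev vz.
have cz : c z = zerow k.
  apply: dot_nondegenerate => // a sa; rewrite -in_word; apply/negbTE.
  have : word c a \in H by rewrite Hc map_f // mem_bits sa.
  by rewrite HE => /andP[].
pose J x := #|[set y in (v : {set Z}) | c y == x]|.
pose mu := #|twins E z|.
have twE y : twins E y = [set y' | extend c v y' == extend c v y] by apply: twinsE cE.
(* The coordinates with the same column as z in E are the ones of v in column 0 of
   H. *)
have muE : mu = J (zerow k).
  rewrite /mu twE; apply: eq_card => y.
  by rewrite !inE /extend eqseq_cons [z \in _]vz cz eqb_id.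
(* Maximality of mu applies to the coordinates with a nonzero column in E. *)
have Jmu y : (c y != zerow k) || (y \in (v : {set Z})) ->
    #|[set y' | extend c v y' == extend c v y]| <= mu.
  rewrite -twE => cy; apply: zmax; apply/exists_inP.
  have [yv|nyv] := boolP (y \in (v : {set Z})); first by exists v.
  rewrite (negPf nyv) orbF in cy.
  have /existsP[A /andP[HA yA]] : [exists A, (A \in H) && (y \in (A : {set Z}))].
    apply: contraNT cy => /existsPn nA; apply/eqP/dot_nondegenerate => // a sa.
    rewrite -in_word; have := nA (word c a); rewrite negb_and => /orP[|/negbTE //].
    by rewrite Hc map_f // mem_bits sa.
  by exists A => //; move: HA; rewrite HE => /andP[].
have mE x : count_mem x s = #|[set y | c y == x]|.
  by rewrite -(seq.permP cs) -(card_sub_codom c (pred1 x)).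
have mJ x : count_mem x s - J x = #|[set y | c y == x] :\: (v : {set Z})|.
  rewrite mE -(cardsID (v : {set Z}) [set y | c y == x]).
  rewrite (_ : _ :&: _ = [set y in (v : {set Z}) | c y == x]) ?addKn //.
  by apply/setP=> y; rewrite !inE andbC.
have Jle x : J x <= count_mem x s.
  by rewrite mE subset_leq_card //; apply/subsetP=> y; rewrite !inE => /andP[].
exists s => //; exists (split_columns (tallied s) [seq J p.1 | p <- tallied s]); last first.
  by exists (extend c v) => //; apply: perm_split.
have permK := perm_split v cs.
rewrite mem_filter; apply/andP; split.
  apply/allP=> a; rewrite mem_bits => /eqP sa.
  have -> : weight (split_columns (tallied s) [seq J p.1 | p <- tallied s]) (true :: a) =
            card (word (extend c v) (true :: a)).
    by rewrite card_word; apply/esym/seq.permP.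
  have : word (extend c v) (true :: a) \in E.
    by case: cE => _ ->; rewrite map_f // mem_bits /= sa.
  have wz : z \in (word (extend c v) (true :: a) : {set Z}).
    by rewrite in_word /extend /= [z \in _]vz cz dotC dot0l.
  move/dE; rewrite /good_weight !inE => /orP[|//].
  by rewrite cards_eq0 => /eqP w0; rewrite w0 inE in wz.
apply: map_f; apply/flatten_mapP; exists mu.
  (* The coordinate z itself shows that mu is positive. *)
  rewrite mem_iota add1n ltnS muE Jle andbT.
  by apply/card_gt0P; exists z; rewrite inE [z \in _]vz cz eqxx.
apply: mem_admissible_splits => //.
- move=> A Ac; apply: (even_meet dE) => //.
  by move: Ac; rewrite -Hc HE => /andP[].
- by rewrite -[X in card X](setIid v); apply: (even_meet dE).
case=> x m /mapP[x' _ [-> ->]] {x m}; rename x' into x.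
rewrite /split_options -/(J x); case: eqP => [->|/eqP nx]; first by rewrite -muE mem_head.
rewrite mem_filter mem_iota add0n ltnS leq0n Jle !andbT mJ.
apply/and3P; split.
- have [->//|/card_gt0P[y]] := posnP (J x); rewrite inE => /andP[yv /eqP cy].
  have := Jmu y; rewrite yv orbT => /(_ isT); apply: leq_trans.
  by apply/subset_leq_card/subsetP=> y'; rewrite !inE /extend eqseq_cons yv cy => /andP[-> ->].
- have [->//|/card_gt0P[y]] := posnP #|[set y | c y == x] :\: (v : {set Z})|.
  rewrite !inE => /andP[yv /eqP cy].
  have := Jmu y; rewrite cy nx => /(_ isT); apply: leq_trans.
  apply/subset_leq_card/subsetP=> y'.
  by rewrite !inE /extend eqseq_cons (negPf yv) cy => /andP[/negPf-> ->].
by apply/implyP=> /vbal.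
Qed.
End Extension.

(** * Classification by induction on the dimension *)

(** Requiring a positive weight for every nonzero combination makes the rows
    independent, so that the code has dimension k. *)
Definition good_columns k (s : seq bitseq) : bool :=
  [&& size s == 21, all (fun x => size x == k) s &
      all (fun a => (a == zerow k) || good_weight (weight s a)) (bits k)].

Definition change_basis (bs s : seq bitseq) : seq bitseq :=
  [seq [seq dot b x | b <- bs] | x <- s].

(** The columns K, rewritten in the basis bs of linear forms, form the i-th entry of T
    up to order. Invertibility of bs need not be tested: the new rows lie in the old
    code, and they are independent because the entries of T are good. *)
Definition check_basis_change k (T : seq (seq bitseq)) (K : seq bitseq)
    (bc : nat * seq bitseq) : bool :=
  let: (i, bs) := bc in
  [&& i < size T, size bs == k, all (fun b => size b == k) bs &
      perm_eq (change_basis bs K) (nth [::] T i)].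

Definition check_extensions k (T T' : seq (seq bitseq))
    (bcs : seq (seq (nat * seq bitseq))) : bool :=
  all2 (fun s => all2 (check_basis_change k.+1 T') (extensions k s)) T bcs.

Lemma all2_mem (S T : eqType) (r : S -> T -> bool) s t x :
  all2 r s t -> x \in s -> exists2 y, y \in t & r x y.
Proof.
elim: s t => [|x' s IHs] [|y t] //= /andP[rxy st]; rewrite inE => /predU1P[->|/(IHs _ st)].
  by exists y; rewrite ?mem_head.
by case=> z tz rz; exists z; rewrite // inE tz orbT.
Qed.

Section Classification.
Variable Z : finType.
Implicit Types (c : Z -> bitseq) (E : {vspace Pow Z}) (A B v : Pow Z).
Local Notation card A := #|(A : {set Z})|.

Lemma good_word_inj k c s : good_columns k s -> (forall y, size (c y) = k) ->
  perm_eq (codom c) s -> {in bits k &, injective (word c)}.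
Proof.
case/and3P=> _ _ /allP gs sc cs; apply: word_inj => // a sa nz; apply/eqP=> w0.
have := gs a; rewrite mem_bits sa eqxx (negPf nz) => /(_ isT).
by rewrite /weight -(seq.permP cs) -card_word w0 [card _]cards0.
Qed.

Lemma word_change_basis k c E bs a : codes k c E ->
  all (fun b => size b == k) bs -> word (fun y => [seq dot b (c y) | b <- bs]) a \in E.
Proof.
move=> [sc Ec]; elim: bs a => [|b bs IHbs] a.
  move=> _; rewrite (_ : word _ a = 0%R) ?mem0v //.
  by apply/setP=> y; rewrite in_word in_zero; case: a.
case: a => [_|u a /= /andP[sb /(IHbs a) Ea]].
  by rewrite (_ : word _ _ = 0%R) ?mem0v //; apply/setP=> y; rewrite in_word in_zero.
rewrite (_ : word _ _ = ((if u then word c b else 0) +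
                         word (fun y => [seq dot b (c y) | b <- bs]) a)%R).
  by rewrite memvD //; case: u; rewrite ?mem0v // Ec map_f // mem_bits.
by apply/setP=> y; rewrite in_add !in_word /=; case: u; rewrite ?in_zero ?in_word.
Qed.

(** The words of the new matrix lie in E; they are distinct by the weights of s, hence
    fill E for reasons of cardinality. *)
Lemma codes_change_basis k c E bs s :
    codes k c E -> \dim E = k -> size bs = k -> all (fun b => size b == k) bs ->
    good_columns k s -> perm_eq (change_basis bs (codom c)) s ->
  exists2 c', codes k c' E & perm_eq (codom c') s.
Proof.
move=> cE dimE sbs bsk gs cs; pose c' y := [seq dot b (c y) | b <- bs].
have cs' : perm_eq (codom c') s by rewrite /change_basis -map_comp in cs.
have sc' y : size (c' y) = k by rewrite size_map.
exists c' => //; apply: codes_subset => //; last exact: good_word_inj gs _ cs'.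
by move=> a _; apply: word_change_basis cE _.
Qed.

(** Induction on the dimension by shortening; the base case is the zero code, with 21
    empty columns. *)
Theorem classification (T : nat -> seq (seq bitseq)) bcs n : #|Z| = 21 ->
    T 0 = [:: nseq 21 [::]] ->
    (forall k, k <= n -> all (good_columns k) (T k)) ->
    (forall k, k < n -> check_extensions k (T k) (T k.+1) (bcs k)) ->
  forall k E, k <= n -> doubly_even E -> \dim E = k ->
  exists2 s, s \in T k & exists2 c, codes k c E & perm_eq (codom c) s.
Proof.
move=> cardZ T0 good check; elim=> [|k IHk] E lekn dE dimE.
  exists (nseq 21 [::]); first by rewrite T0 mem_head.
  exists (fun=> [::]); last first.
    by rewrite -cardZ cardE /codom /image_mem; elim: (enum _) => //= _ e; rewrite perm_cons.
  split=> // A; move/eqP: dimE; rewrite dimv_eq0 => /eqP->.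
  by rewrite memv0 /= inE (word_zero _ 0).
have [s Ts [K sK [c cE cK]]] :=
  extension_complete dE dimE (fun H => IHk H (ltnW lekn)).
have [cs _ sKs] := all2_mem (check k lekn) Ts.
have [[i bs] _ /and4P[ltiT /eqP sbs bsk bsT]] := all2_mem sKs sK.
have Ti : nth [::] (T k.+1) i \in T k.+1 by apply: mem_nth.
exists (nth [::] (T k.+1) i) => //.
apply: codes_change_basis cE dimE sbs bsk _ _; first exact: (allP (good _ lekn)).
by apply: perm_trans bsT; apply: perm_map.
Qed.

End Classification.

(** * Invariants *)

(** From here on a code is only seen through the group F_2^k and the weight function w
    on it. *)
Definition octads (w : bitseq -> nat) k := [seq a <- bits k | w a == 8].

Definition neighbours (w : bitseq -> nat) (S : seq bitseq) a :=
  [seq b <- S | w (addw a b) == 8].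

(** How many words of weight 8, 12 and 16 have exactly c words of weight 8 at distance
    8. Restricting c to a fixed range keeps this an invariant. *)
Definition pair_stat (w : bitseq -> nat) k : seq nat :=
  let S := octads w k in
  let l := [seq (w a, size (neighbours w S a)) | a <- bits k] in
  [seq count_mem p l | p <- allpairs pair [:: 8; 12; 16] (iota 0 33)].

(** The number of triples (a, b, d) of words of weight 8 whose pairwise sums have weight
    8. With the word 0 these are cliques of size 4 in the Cayley graph of the words of
    weight 8. For a two-weight code this graph is strongly regular, so that pair counts
    cannot separate codes with the same parameters, whereas these cliques can. *)
Definition clique_stat (w : bitseq -> nat) k : nat :=
  let S := octads w k in
  sumn [seq (let N := neighbours w S a in
             sumn [seq size (neighbours w N b) | b <- N]) | a <- S].

Definition weight_table k s : bitseq -> nat := lookup (tabulate k (weight s)).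

(** The cliques are only counted for pairs that the first statistic does not separate. *)
Definition distinct k (T : seq (seq bitseq)) : bool :=
  pairwise (fun p q => if p.1 == q.1 then
      clique_stat (weight_table k p.2) k != clique_stat (weight_table k q.2) k
    else true)
  [seq (pair_stat (weight_table k s) k, s) | s <- T].

(** Additive bijections preserving the weight preserve both statistics. *)
Section Invariance.
Variables (k : nat) (w w' : bitseq -> nat) (f : bitseq -> bitseq).
Hypothesis f_perm : perm_eq (map f (bits k)) (bits k).
Hypothesis fD : {in bits k &, forall a b, f (addw a b) = addw (f a) (f b)}.
Hypothesis fw : {in bits k, forall a, w' (f a) = w a}.

Lemma octads_perm : perm_eq (map f (octads w k)) (octads w' k).
Proof.
apply: perm_trans (perm_filter (fun a => w' a == 8) f_perm); rewrite filter_map.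
by rewrite (@eq_in_filter _ _ (fun a => w a == 8)) // => a /= /fw->.
Qed.

Lemma neighbours_perm S S' a : {subset S <= bits k} -> perm_eq (map f S) S' ->
  a \in bits k -> perm_eq (map f (neighbours w S a)) (neighbours w' S' (f a)).
Proof.
move=> Sk SS' ak; apply: perm_trans (perm_filter (fun b => w' (addw (f a) b) == 8) SS').
rewrite filter_map (@eq_in_filter _ _ (fun b => w (addw a b) == 8)) // => b /Sk bk /=.
rewrite -fD // fw //; move: ak bk.
by rewrite !mem_bits => /eqP sa /eqP sb; rewrite size_addw ?sa ?sb.
Qed.

Lemma pair_stat_invariant : pair_stat w k = pair_stat w' k.
Proof.
rewrite /pair_stat; apply: eq_map => p.
have /(_ _ (fun a => (w' a, size (neighbours w' (octads w' k) a)))) := perm_map _ f_perm.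
move=> /seq.permP <-; rewrite -map_comp; congr (count _ _).
apply/eq_in_map => a ak /=; rewrite fw //; congr (_, _).
rewrite -(perm_size (neighbours_perm _ octads_perm ak)) ?size_map //.
by move=> b; rewrite mem_filter => /andP[].
Qed.

Lemma clique_stat_invariant : clique_stat w k = clique_stat w' k.
Proof.
have Sk : {subset octads w k <= bits k} by move=> b; rewrite mem_filter => /andP[].
rewrite /clique_stat -(perm_sumn (perm_map _ octads_perm)) -map_comp.
congr sumn; apply/eq_in_map => a /Sk ak /=.
have nS := neighbours_perm Sk octads_perm ak.
have Nk : {subset neighbours w (octads w k) a <= bits k}.
  by move=> b; rewrite mem_filter => /andP[_ /Sk].
rewrite -(perm_sumn (perm_map _ nS)) -map_comp; congr sumn.
apply/eq_in_map => b /Nk bk /=.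
by rewrite -(perm_size (neighbours_perm Nk nS bk)) size_map.
Qed.
End Invariance.

(** * Counting classes *)

Lemma card_equivalence_partition (T : finType) (I : eqType) (R : rel T)
    (D : {set T}) (L : seq I) (F : I -> T) :
    equivalence_rel R -> {in L, forall i, F i \in D} ->
    (forall x, x \in D -> exists2 i, i \in L & R x (F i)) ->
    pairwise (fun i j => ~~ R (F i) (F j)) L ->
  #|equivalence_partition R D| = size L.
Proof.
move=> eqR FD cover distinctL; pose P x := [set y in D | R x y].
have R_refl x : R x x by have [] := eqR x x x.
have PE x y : R x y -> P x = P y.
  by move=> Rxy; apply/setP=> z; rewrite !inE; have [_ ->] := eqR x y z.
rewrite -(size_map (P \o F)) -(card_uniqP _); last first.
  rewrite uniq_pairwise pairwise_map.
  apply: (sub_in_pairwise (P := [in L])) distinctL => [i j iL jL|]; last exact/allP.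
  apply: contraNneq => /= /setP/(_ (F j)); rewrite !inE FD //= R_refl.
  by case: (R _ _).
apply: eq_card => X; apply/imsetP/mapP=> [[x xD ->]|[i iL ->]].
  by have [i iL Rxi] := cover x xD; exists i; rewrite //= -(PE _ _ Rxi).
by exists (F i); rewrite ?FD.
Qed.

Section Counting.
Variable Z : finType.
Implicit Types (c : Z -> bitseq) (C E : {vspace Pow Z}) (A B v : Pow Z).
Local Notation card A := #|(A : {set Z})|.

Lemma in_perm_word (tau : {perm Z}) A y :
  (tau y \in (perm_word tau A : {set Z})) = (y \in (A : {set Z})).
Proof. by rewrite mem_imset //; apply: perm_inj. Qed.

Lemma perm_word_add (tau : {perm Z}) A B :
  perm_word tau (A + B)%R = (perm_word tau A + perm_word tau B)%R.
Proof.
apply/setP=> y; rewrite -[y](permKV tau) in_add !in_perm_word; exact: in_add.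
Qed.

Lemma card_perm_word (tau : {perm Z}) A : card (perm_word tau A) = card A.
Proof. by rewrite card_imset //; apply: perm_inj. Qed.

(** Coordinates can be matched by a permutation when each column occurs equally often. *)
Lemma perm_codom c c' : perm_eq (codom c') (codom c) ->
  exists tau : {perm Z}, forall y, c' (tau y) = c y.
Proof.
rewrite perm_sym => /(@tuple_permP _ _ _ (codom_tuple c'))[p cE].
have tauI : injective (fun y => enum_val (p (enum_rank y))).
  by move=> y z /enum_val_inj/perm_inj/enum_rank_inj.
exists (perm tauI) => y; rewrite permE -(nth_codom [::]) -[RHS](congr1 c (enum_rankK y)).
by rewrite -(nth_codom [::] c) cE nth_mktuple (tnth_nth [::]).
Qed.

Lemma code_equiv_of_columns k c c' C C' : codes k c C -> codes k c' C' ->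
  perm_eq (codom c) (codom c') -> code_equiv C C'.
Proof.
move=> [_ Cc] [_ Cc'] /perm_codom[tau tauE]; apply/existsP; exists tau^-1%g.
have tw a : perm_word tau^-1%g (word c a) = word c' a.
  by apply/setP=> y; rewrite -{1}[y](permK tau) in_perm_word !in_word tauE.
apply/eqP/setP=> A; rewrite inE Cc'; apply/imsetP/mapP=> [[B]|[a ak ->]].
  by rewrite Cc => /mapP[a ak ->] ->; exists a.
by exists (word c a); rewrite ?tw // Cc map_f.
Qed.

(** The columns of the generator matrix of C = E + <Z>, whose first row is Z. *)
Definition allones_column c y : bitseq := true :: c y.

Lemma codom_allones c : codom (allones_column c) = map (cons true) (codom c).
Proof. by rewrite [codom c]codomE -map_comp codomE. Qed.

Lemma word_allones c b a :
  word (allones_column c) (b :: a) = ((if b then [set: Z] : Pow Z else 0) + word c a)%R.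
Proof.
rewrite -word_extend; apply/setP=> y.
by rewrite !in_word /= in_setT.
Qed.

Lemma card_word_allones k c s b a : #|Z| = 21 -> good_columns k s ->
    perm_eq (codom c) s -> size a = k ->
  card (word (allones_column c) (b :: a)) = if b then 21 - weight s a else weight s a.
Proof.
move=> cardZ gs cs sa; rewrite word_allones /weight -(seq.permP cs) -card_word.
case: b; last by rewrite add0r.
rewrite -cardZ -(cardsC (word c a : {set Z})) addKn; apply: eq_card => y.
by rewrite in_add in_setT in_setC.
Qed.

Lemma weight_good k s a : good_columns k s -> size a = k ->
  weight s a \in [:: 0; 8; 12; 16].
Proof.
case/and3P=> _ _ /allP gs sa; have := gs a; rewrite mem_bits sa eqxx.
move=> /(_ isT)/orP[/eqP->|]; last by rewrite /good_weight !inE => ->; rewrite orbT.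
by rewrite /weight (eq_count (dot0l k)) count_pred0.
Qed.

Lemma allones_weight_nz k c s b a : #|Z| = 21 -> good_columns k s -> perm_eq (codom c) s ->
  size a = k -> b :: a != zerow k.+1 -> word (allones_column c) (b :: a) != 0%R.
Proof.
move=> cardZ gs cs sa nz; rewrite -cards_eq0 (card_word_allones _ cardZ gs cs sa).
have := weight_good gs sa; case/and3P: gs => _ _ /allP/(_ a); rewrite mem_bits sa eqxx.
case: b nz => [_ _|]; first by rewrite !inE => /or4P[] /eqP->.
rewrite [zerow k.+1]/= eqseq_cons eqxx andTb => /negPf->.
by move=> /(_ isT) /=; rewrite /good_weight !inE => /or3P[] /eqP->.
Qed.

Lemma allones_inj k c s : #|Z| = 21 -> good_columns k s -> (forall y, size (c y) = k) ->
  perm_eq (codom c) s -> {in bits k.+1 &, injective (word (allones_column c))}.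
Proof.
move=> cardZ gs sc cs; apply: word_inj => [y|[|b a] // [sa]]; first by rewrite /= sc.
exact: allones_weight_nz cs sa.
Qed.

Lemma allones_admissible k c s C : k <= 10 -> #|Z| = 21 -> good_columns k s ->
    (forall y, size (c y) = k) -> perm_eq (codom c) s ->
    codes k.+1 (allones_column c) C -> C \in admissible_codes Z (10 - k).
Proof.
move=> lek cardZ gs sc cs cC; rewrite inE (codes_dim cC (allones_inj cardZ gs sc cs)).
case: cC => _ Cc; apply/and3P; split.
- by rewrite (@subSn _ 10) ?leq_subr // subKn.
- have -> : ([set: Z] : Pow Z) = word (allones_column c) (true :: zerow k).
    by rewrite word_allones word_zero addr0.
  by rewrite Cc map_f // mem_bits /= size_nseq.
apply/forallP=> A; apply/implyP; rewrite Cc => /mapP[[|b a]]; rewrite mem_bits // => /eqP[sa] ->.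
rewrite (card_word_allones _ cardZ gs cs sa).
by have := weight_good gs sa; case: b; rewrite !inE => /or4P[] /eqP->.
Qed.

(** The words of even weight form a hyperplane of C, as Z has odd weight. *)
Lemma admissible_even_part k C : k <= 10 -> #|Z| = 21 -> C \in admissible_codes Z (10 - k) ->
  exists2 E : {vspace Pow Z}, doubly_even E /\ \dim E = k &
    forall c, codes k c E -> codes k.+1 (allones_column c) C.
Proof.
move=> lek cardZ; rewrite inE => /and3P[/eqP dimC CZ /forallP wC].
have oddZ : odd (card ([set: Z] : Pow Z)) by rewrite cardsT cardZ.
have [E [dimE EC]] :=
  hyperplane (phi := fun A => odd (card A)) (@odd_card_add Z) CZ oddZ.
exists E; first split.
- move=> A; rewrite EC => /andP[CA]; have := wC A; rewrite CA /= !inE.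
  by case/orP=> [/eqP->|/or4P[/eqP->|/eqP->|/eqP->|]] //; case/or4P=> /eqP->.
- by apply/eqP; rewrite -eqSS -dimE dimC (@subSn _ 10) ?leq_subr // subKn.
move=> c cE; have := codes_extend cE (@odd_card_add Z) EC CZ oddZ.
case=> s1 C1; split=> // A; rewrite C1; congr (A \in _); apply: eq_map => a.
by apply/setP=> y; rewrite !in_word /extend in_setT.
Qed.

(** A permutation of coordinates preserves the parity of the weight, hence maps the even
    subcode to the even subcode. In terms of the rows of the two matrices it becomes an
    additive bijection of F_2^k that preserves weights. *)
Lemma code_equiv_invariant k c c' s s' C C' : #|Z| = 21 ->
    good_columns k s -> (forall y, size (c y) = k) -> perm_eq (codom c) s ->
    good_columns k s' -> (forall y, size (c' y) = k) -> perm_eq (codom c') s' ->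
    codes k.+1 (allones_column c) C -> codes k.+1 (allones_column c') C' ->
    code_equiv C C' ->
  pair_stat (weight_table k s) k = pair_stat (weight_table k s') k /\
  clique_stat (weight_table k s) k = clique_stat (weight_table k s') k.
Proof.
move=> cardZ gs sc cs gs' sc' cs' [_ Cc] [_ Cc'] /existsP[tau /eqP/setP tauC].
have cI' := good_word_inj gs' sc' cs'; have cI := good_word_inj gs sc cs.
have fP a : a \in bits k ->
    exists2 a', a' \in bits k & perm_word tau (word c a) = word c' a'.
  rewrite mem_bits => /eqP sa.
  have : perm_word tau (word (allones_column c) (false :: a)) \in [set A in C'].
    by rewrite -tauC imset_f // Cc map_f // mem_bits /= sa.
  rewrite inE Cc' => /mapP[[|b a']]; rewrite mem_bits // => /eqP[sa'] eq_w.
  have := congr1 (fun A : Pow Z => odd (card A)) eq_w.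
  rewrite card_perm_word (card_word_allones _ cardZ gs cs sa).
  rewrite (card_word_allones _ cardZ gs' cs' sa').
  have even_weight t u : good_columns k t -> size u = k -> odd (weight t u) = false.
    by move=> gt su; have := weight_good gt su; rewrite !inE => /or4P[] /eqP->.
  have := weight_good gs' sa'; rewrite (even_weight _ _ gs sa).
  (* The image cannot involve Z, for its weight would be odd. *)
  case: b eq_w => eq_w; first by rewrite !inE => /or4P[] /eqP->.
  move=> _ _; exists a'; first by rewrite mem_bits sa'.
  by move: eq_w; rewrite !word_allones !add0r.
(* The action of tau on the even subcode, read off on combinations of rows. *)
pose f a := nth [::] (bits k) (find (fun a' => perm_word tau (word c a) == word c' a') (bits k)).
have fE a : a \in bits k -> perm_word tau (word c a) = word c' (f a).
  move=> /fP[a' ka' eq_a']; apply/eqP.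
  apply: (@nth_find _ [::] (fun a' => perm_word tau (word c a) == word c' a')).
  by apply/hasP; exists a'; rewrite ?eq_a'.
have fk a : a \in bits k -> f a \in bits k.
  by move=> /fP[a' ka' eq_a']; rewrite mem_nth // -has_find; apply/hasP; exists a'; rewrite ?eq_a'.
have addk a b : a \in bits k -> b \in bits k -> addw a b \in bits k.
  by rewrite !mem_bits => /eqP sa /eqP sb; rewrite size_addw ?sa ?sb.
have wD (g : Z -> bitseq) a b : a \in bits k -> b \in bits k ->
    word g (addw a b) = (word g a + word g b)%R.
  by rewrite !mem_bits => /eqP sa /eqP sb; rewrite word_add ?sa ?sb.
have fD : {in bits k &, forall a b, f (addw a b) = addw (f a) (f b)}.
  move=> a b ak bk; apply: cI'; rewrite ?fk ?addk ?fk //.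
  by rewrite -fE ?addk // wD // perm_word_add !fE // wD ?fk.
have fI : {in bits k &, injective f}.
  move=> a b ak bk eq_f; apply: cI => //; apply: (imset_inj (@perm_inj _ tau)).
  by rewrite -/(perm_word _ _) fE // eq_f -fE.
have f_perm : perm_eq (map f (bits k)) (bits k).
  have Uf : uniq (map f (bits k)) by rewrite map_inj_in_uniq ?uniq_bits.
  apply: uniq_perm => //; first exact: uniq_bits.
  apply: (uniq_min_size Uf _ _).2; last by rewrite size_map.
  by move=> _ /mapP[a ak ->]; apply: fk.
have fw : {in bits k, forall a, weight_table k s' (f a) = weight_table k s a}.
  move=> a ak; have := fk a ak; move: (ak); rewrite !mem_bits => /eqP sa /eqP sfa.
  rewrite /weight_table !lookup_tabulate // /weight -(seq.permP cs) -(seq.permP cs').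
  by rewrite -!card_word -fE // card_perm_word.
by split; [apply: pair_stat_invariant f_perm fD fw|apply: clique_stat_invariant f_perm fD fw].
Qed.

Definition listed_column (s : seq bitseq) (y : Z) : bitseq := nth [::] s (enum_rank y).

Lemma codom_listed s : size s = #|Z| -> codom (listed_column s) = s.
Proof.
move=> szs; apply: (@eq_from_nth _ [::]); rewrite size_codom // => i ltiZ.
by rewrite (nth_codom [::] _ (Ordinal ltiZ)) /listed_column enum_valK.
Qed.

Lemma count_classes k (T : seq (seq bitseq)) : k <= 10 -> #|Z| = 21 ->
    all (good_columns k) T -> distinct k T ->
    (forall E, doubly_even E -> \dim E = k ->
       exists2 s, s \in T & exists2 c : Z -> bitseq, codes k c E & perm_eq (codom c) s) ->
  r Z (10 - k) = size T.
Proof.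
move=> lek cardZ /allP goodT distT cover.
have szT s : s \in T -> size s = #|Z|.
  by move=> /goodT/and3P[/eqP->]; rewrite cardZ.
have colT s : s \in T -> perm_eq (codom (listed_column s)) s.
  by move=> /szT/codom_listed->.
have lenT s y : s \in T -> size (listed_column s y) = k.
  move=> Ts; have /and3P[_ /allP sk _] := goodT s Ts; apply/eqP/sk.
  by rewrite mem_nth // szT.
have FP s : s \in T -> codes k.+1 (allones_column (listed_column s))
    (code k.+1 (allones_column (listed_column s))).
  by move=> Ts; apply: codes_code => y; rewrite /= lenT.
apply: (card_equivalence_partition (F := fun s => code k.+1 (allones_column (listed_column s)))).
- exact: code_equiv_is_equivalence.
- move=> s Ts.
  apply: (allones_admissible lek cardZ (goodT s Ts) _ (colT s Ts) (FP s Ts)) => y.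
  exact: lenT.
- move=> C /(admissible_even_part lek cardZ)[E [dE dimE] CE].
  have [s Ts [c /CE cC cs]] := cover E dE dimE; exists s => //.
  apply: code_equiv_of_columns cC (FP s Ts) _.
  rewrite !codom_allones.
  by apply: perm_map; rewrite (codom_listed (szT s Ts)).
move: distT; rewrite /distinct pairwise_map.
apply: (sub_in_pairwise (P := [in T])); last exact/allP.
move=> s s' Ts Ts' /=; apply: contraTN => eqC.
have [-> ->] := code_equiv_invariant cardZ (goodT s Ts) (fun y => lenT s y Ts) (colT s Ts)
  (goodT s' Ts') (fun y => lenT s' y Ts') (colT s' Ts') (FP s Ts) (FP s' Ts') eqC.
by rewrite !eqxx.
Qed.
End Counting.

(** * The tables *)

(** Bit i of the number is entry i of the vector, so that the unit vectors are the
    powers of 2. *)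
Fixpoint pos_bits k p : bitseq :=
  if k is k'.+1 then match p with
    | xH => true :: zerow k'
    | xO p' => false :: pos_bits k' p'
    | xI p' => true :: pos_bits k' p'
    end else [::].

Definition num_bits k (n : N) : bitseq :=
  if n is Npos p then pos_bits k p else zerow k.

(** In the table of dimension k, an entry lists the 21 columns of a generator matrix.
    It contains the powers of 2, that is, all the unit columns: the matrix is in
    systematic form up to the order of the coordinates. *)

Definition columns0 : seq (seq N) := [::
  [:: 0; 0; 0; 0; 0; 0; 0; 0; 0; 0; 0; 0; 0; 0; 0; 0; 0; 0; 0; 0; 0]]%num.

Definition columns1 : seq (seq N) := [::
  [:: 0; 0; 0; 0; 0; 0; 0; 0; 0; 0; 0; 0; 0; 1; 1; 1; 1; 1; 1; 1; 1];
  [:: 0; 0; 0; 0; 0; 0; 0; 0; 0; 1; 1; 1; 1; 1; 1; 1; 1; 1; 1; 1; 1];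
  [:: 0; 0; 0; 0; 0; 1; 1; 1; 1; 1; 1; 1; 1; 1; 1; 1; 1; 1; 1; 1; 1]]%num.

Definition columns2 : seq (seq N) := [::
  [:: 0; 0; 0; 0; 0; 0; 0; 0; 0; 1; 1; 1; 1; 2; 2; 2; 2; 3; 3; 3; 3];
  [:: 0; 0; 0; 0; 0; 0; 0; 1; 1; 2; 2; 2; 2; 2; 2; 3; 3; 3; 3; 3; 3];
  [:: 0; 0; 0; 0; 0; 1; 1; 1; 1; 1; 1; 1; 1; 2; 2; 2; 2; 2; 2; 2; 2];
  [:: 0; 0; 0; 0; 0; 1; 1; 1; 1; 2; 2; 2; 2; 3; 3; 3; 3; 3; 3; 3; 3];
  [:: 0; 0; 0; 1; 1; 2; 2; 2; 2; 2; 2; 3; 3; 3; 3; 3; 3; 3; 3; 3; 3];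
  [:: 0; 1; 1; 1; 1; 2; 2; 2; 2; 3; 3; 3; 3; 3; 3; 3; 3; 3; 3; 3; 3];
  [:: 0; 0; 0; 1; 1; 1; 1; 1; 1; 2; 2; 2; 2; 2; 2; 3; 3; 3; 3; 3; 3];
  [:: 0; 1; 1; 1; 1; 2; 2; 2; 2; 2; 2; 2; 2; 3; 3; 3; 3; 3; 3; 3; 3]]%num.

Definition columns3 : seq (seq N) := [::
  [:: 0; 0; 0; 0; 0; 0; 0; 1; 1; 2; 2; 3; 3; 4; 4; 5; 5; 6; 6; 7; 7];
  [:: 0; 0; 0; 0; 0; 0; 1; 2; 3; 4; 4; 4; 5; 5; 5; 6; 6; 6; 7; 7; 7];
  [:: 0; 0; 0; 0; 0; 1; 1; 1; 1; 2; 2; 2; 2; 4; 4; 4; 4; 7; 7; 7; 7];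
  [:: 0; 0; 0; 0; 0; 1; 1; 2; 2; 3; 3; 3; 3; 4; 4; 5; 5; 5; 5; 7; 7];
  [:: 0; 0; 0; 0; 1; 2; 3; 3; 3; 4; 5; 5; 5; 6; 6; 6; 7; 7; 7; 7; 7];
  [:: 0; 0; 0; 1; 1; 2; 2; 3; 3; 3; 3; 3; 3; 4; 4; 4; 4; 5; 5; 5; 5];
  [:: 0; 0; 0; 1; 1; 2; 2; 3; 3; 3; 3; 3; 3; 4; 4; 5; 5; 6; 6; 7; 7];
  [:: 0; 0; 1; 2; 3; 4; 4; 4; 5; 5; 5; 5; 5; 5; 5; 6; 6; 6; 7; 7; 7];
  [:: 0; 1; 1; 1; 1; 2; 2; 2; 2; 3; 3; 3; 3; 4; 4; 4; 4; 4; 4; 4; 4];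
  [:: 0; 1; 1; 2; 2; 3; 3; 3; 3; 3; 3; 3; 3; 4; 4; 5; 5; 5; 5; 7; 7];
  [:: 1; 2; 3; 3; 3; 4; 5; 5; 5; 6; 6; 6; 7; 7; 7; 7; 7; 7; 7; 7; 7];
  [:: 0; 0; 0; 1; 1; 2; 2; 3; 3; 4; 4; 4; 4; 6; 6; 6; 6; 7; 7; 7; 7];
  [:: 0; 0; 1; 2; 3; 3; 3; 3; 3; 4; 5; 6; 6; 6; 6; 6; 7; 7; 7; 7; 7];
  [:: 0; 0; 1; 2; 3; 3; 3; 3; 3; 4; 4; 4; 5; 5; 5; 6; 6; 6; 7; 7; 7];
  [:: 0; 1; 1; 2; 2; 4; 4; 4; 4; 5; 5; 5; 5; 5; 5; 6; 6; 6; 6; 6; 6];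
  [:: 0; 1; 1; 2; 2; 3; 3; 3; 3; 4; 4; 5; 5; 5; 5; 7; 7; 7; 7; 7; 7];
  [:: 1; 2; 3; 3; 3; 3; 3; 3; 3; 4; 5; 5; 5; 6; 6; 6; 7; 7; 7; 7; 7];
  [:: 0; 1; 1; 1; 1; 2; 2; 2; 2; 3; 3; 3; 3; 4; 4; 4; 4; 5; 5; 5; 5];
  [:: 0; 1; 1; 2; 2; 3; 3; 3; 3; 4; 4; 5; 5; 5; 5; 6; 6; 6; 6; 7; 7];
  [:: 1; 2; 3; 3; 3; 4; 4; 4; 5; 5; 5; 5; 5; 6; 6; 6; 6; 6; 7; 7; 7];
  [:: 1; 1; 1; 2; 2; 2; 3; 3; 3; 4; 4; 4; 5; 5; 5; 6; 6; 6; 7; 7; 7]]%num.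

Definition columns4 : seq (seq N) := [::
  [:: 0; 0; 0; 0; 0; 0; 1; 2; 3; 4; 5; 6; 7; 8; 9; 10; 11; 12; 13; 14; 15];
  [:: 0; 0; 0; 0; 0; 1; 1; 2; 2; 4; 4; 7; 7; 8; 8; 11; 11; 13; 13; 14; 14];
  [:: 0; 0; 0; 0; 0; 1; 2; 3; 3; 4; 5; 5; 7; 8; 9; 9; 11; 13; 14; 15; 15];
  [:: 0; 0; 0; 0; 1; 2; 3; 3; 3; 4; 5; 6; 7; 8; 8; 9; 9; 12; 12; 14; 14];
  [:: 0; 0; 0; 1; 1; 2; 2; 3; 3; 4; 4; 5; 5; 8; 8; 9; 9; 14; 14; 14; 14];
  [:: 0; 0; 0; 1; 2; 3; 3; 3; 3; 4; 5; 5; 7; 8; 9; 9; 11; 12; 12; 13; 14];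
  [:: 0; 0; 1; 2; 3; 3; 3; 3; 3; 4; 5; 6; 7; 8; 8; 9; 9; 12; 12; 13; 13];
  [:: 0; 0; 1; 2; 3; 3; 3; 3; 3; 4; 5; 6; 7; 8; 9; 10; 11; 12; 13; 14; 15];
  [:: 0; 1; 1; 2; 2; 3; 3; 4; 4; 5; 5; 6; 6; 8; 8; 15; 15; 15; 15; 15; 15];
  [:: 0; 1; 2; 3; 3; 3; 3; 3; 3; 4; 5; 5; 7; 8; 9; 9; 11; 13; 14; 15; 15];
  [:: 1; 2; 3; 3; 3; 3; 3; 3; 3; 4; 5; 6; 7; 8; 8; 9; 9; 12; 12; 14; 14];
  [:: 0; 0; 0; 1; 2; 4; 7; 7; 7; 8; 10; 10; 11; 12; 12; 13; 14; 14; 14; 15; 15];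
  [:: 0; 0; 0; 1; 2; 4; 7; 7; 7; 8; 11; 11; 11; 13; 13; 13; 14; 14; 14; 15; 15];
  [:: 0; 0; 1; 2; 3; 4; 5; 6; 6; 6; 7; 7; 7; 8; 8; 9; 9; 12; 12; 12; 12];
  [:: 0; 0; 1; 2; 3; 4; 5; 6; 7; 8; 8; 9; 9; 10; 10; 11; 11; 12; 12; 12; 12];
  [:: 0; 1; 2; 4; 7; 7; 7; 7; 7; 8; 11; 12; 12; 13; 13; 13; 14; 14; 14; 15; 15];
  [:: 0; 1; 2; 4; 7; 7; 7; 7; 7; 8; 9; 9; 10; 10; 11; 12; 12; 13; 14; 15; 15];
  [:: 1; 2; 3; 4; 5; 5; 5; 6; 6; 6; 7; 7; 7; 8; 8; 12; 12; 12; 12; 12; 12];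
  [:: 1; 2; 3; 4; 5; 5; 5; 6; 7; 8; 8; 10; 10; 11; 11; 12; 12; 12; 12; 12; 12];
  [:: 0; 1; 1; 1; 1; 2; 2; 2; 2; 4; 4; 4; 4; 8; 8; 8; 8; 15; 15; 15; 15];
  [:: 0; 1; 1; 2; 2; 3; 3; 3; 3; 4; 4; 7; 7; 8; 8; 8; 8; 13; 13; 13; 13];
  [:: 0; 1; 2; 4; 7; 8; 8; 8; 9; 9; 9; 9; 11; 11; 11; 13; 13; 13; 14; 14; 14];
  [:: 0; 1; 1; 2; 2; 3; 3; 3; 3; 4; 4; 7; 7; 8; 8; 11; 11; 13; 13; 14; 14];
  [:: 0; 0; 0; 1; 1; 2; 2; 4; 4; 6; 6; 7; 7; 8; 8; 10; 10; 11; 11; 15; 15];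
  [:: 0; 0; 1; 2; 3; 4; 5; 6; 6; 6; 7; 7; 7; 8; 8; 10; 10; 12; 12; 15; 15];
  [:: 0; 1; 1; 2; 2; 3; 3; 3; 3; 4; 4; 5; 5; 8; 8; 10; 10; 13; 13; 13; 13];
  [:: 0; 1; 1; 2; 2; 3; 3; 4; 4; 7; 7; 7; 7; 8; 8; 9; 9; 11; 11; 14; 14];
  [:: 0; 1; 2; 3; 3; 3; 3; 4; 6; 6; 7; 7; 7; 8; 11; 13; 14; 14; 14; 15; 15];
  [:: 0; 1; 2; 3; 3; 3; 3; 4; 5; 5; 5; 5; 7; 8; 9; 9; 9; 9; 11; 13; 14];
  [:: 0; 1; 2; 3; 3; 3; 3; 4; 5; 5; 6; 6; 7; 8; 9; 9; 10; 10; 11; 13; 14];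
  [:: 1; 2; 3; 4; 5; 6; 6; 6; 6; 6; 7; 7; 7; 8; 8; 10; 10; 10; 10; 15; 15];
  [:: 1; 2; 3; 4; 5; 6; 6; 6; 6; 6; 7; 7; 7; 8; 8; 9; 9; 10; 10; 12; 12];
  [:: 0; 1; 2; 3; 3; 4; 7; 7; 7; 8; 9; 9; 10; 10; 11; 11; 11; 12; 12; 13; 14];
  [:: 0; 1; 2; 3; 3; 4; 7; 7; 7; 8; 11; 11; 11; 12; 12; 13; 13; 13; 14; 14; 14];
  [:: 1; 2; 3; 3; 3; 4; 5; 5; 5; 6; 6; 6; 7; 8; 8; 8; 8; 15; 15; 15; 15];
  [:: 1; 2; 3; 3; 3; 4; 5; 5; 5; 6; 7; 7; 7; 8; 8; 9; 9; 14; 14; 14; 14];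
  [:: 1; 2; 3; 3; 3; 4; 5; 6; 7; 8; 8; 10; 10; 10; 10; 11; 11; 13; 13; 13; 13];
  [:: 1; 2; 3; 4; 5; 6; 7; 7; 7; 8; 8; 11; 11; 11; 11; 12; 12; 13; 13; 14; 14];
  [:: 1; 2; 3; 3; 3; 4; 5; 5; 5; 6; 6; 6; 7; 8; 8; 9; 9; 10; 10; 11; 11];
  [:: 1; 2; 3; 3; 3; 4; 5; 5; 5; 6; 6; 6; 7; 8; 9; 10; 11; 12; 13; 14; 15];
  [:: 0; 1; 1; 2; 2; 4; 4; 6; 6; 8; 8; 9; 9; 12; 12; 13; 13; 14; 14; 15; 15];
  [:: 1; 2; 3; 3; 3; 4; 5; 6; 6; 6; 7; 7; 7; 8; 8; 9; 9; 13; 13; 14; 14];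
  [:: 1; 2; 3; 3; 3; 4; 5; 6; 7; 8; 8; 11; 11; 12; 12; 13; 13; 14; 14; 15; 15]]%num.

Definition columns5 : seq (seq N) := [::
  [:: 0; 0; 0; 0; 0; 1; 2; 4; 7; 8; 11; 13; 14; 16; 19; 21; 22; 25; 26; 28; 31];
  [:: 0; 0; 0; 0; 1; 2; 3; 4; 5; 8; 9; 14; 14; 16; 18; 20; 23; 24; 27; 29; 31];
  [:: 0; 0; 0; 1; 2; 3; 4; 5; 6; 8; 15; 15; 15; 16; 17; 18; 20; 24; 25; 26; 28];
  [:: 0; 0; 1; 2; 3; 4; 5; 6; 7; 8; 9; 10; 11; 16; 17; 18; 19; 28; 28; 28; 28];
  [:: 0; 1; 2; 3; 4; 5; 6; 8; 15; 15; 15; 15; 15; 16; 17; 18; 21; 22; 23; 27; 28];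
  [:: 1; 2; 3; 4; 5; 8; 9; 14; 14; 14; 14; 14; 14; 16; 18; 20; 23; 24; 27; 29; 31];
  [:: 0; 0; 0; 1; 2; 3; 3; 4; 7; 8; 11; 13; 14; 16; 16; 21; 21; 25; 25; 31; 31];
  [:: 0; 1; 1; 2; 2; 4; 4; 7; 7; 8; 8; 11; 11; 16; 16; 19; 19; 29; 29; 29; 29];
  [:: 0; 1; 2; 3; 3; 3; 3; 4; 7; 8; 11; 13; 14; 16; 16; 21; 21; 25; 25; 28; 28];
  [:: 0; 1; 2; 3; 3; 3; 3; 4; 7; 8; 11; 13; 14; 16; 19; 21; 22; 25; 26; 28; 31];
  [:: 0; 0; 0; 1; 2; 3; 3; 4; 5; 8; 10; 13; 13; 16; 17; 21; 22; 26; 26; 28; 30];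
  [:: 0; 0; 1; 2; 3; 3; 4; 5; 5; 8; 15; 15; 15; 16; 17; 17; 23; 24; 25; 26; 28];
  [:: 0; 0; 1; 2; 3; 3; 4; 5; 7; 8; 13; 13; 13; 16; 17; 19; 23; 24; 26; 27; 28];
  [:: 0; 1; 2; 3; 3; 4; 5; 5; 7; 8; 9; 14; 15; 16; 18; 20; 22; 25; 25; 25; 25];
  [:: 0; 1; 2; 3; 3; 4; 5; 5; 7; 8; 11; 13; 14; 16; 16; 22; 22; 25; 25; 25; 25];
  [:: 0; 1; 2; 3; 4; 7; 7; 7; 7; 8; 9; 11; 14; 16; 17; 19; 22; 25; 26; 27; 28];
  [:: 1; 2; 3; 3; 4; 5; 5; 8; 15; 15; 15; 15; 15; 16; 17; 19; 21; 23; 23; 25; 30];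
  [:: 1; 2; 3; 4; 7; 7; 7; 7; 7; 8; 9; 12; 14; 16; 17; 20; 22; 27; 27; 29; 30];
  [:: 0; 0; 1; 2; 3; 3; 4; 7; 7; 8; 9; 10; 12; 16; 17; 17; 23; 24; 29; 29; 31];
  [:: 0; 0; 1; 2; 3; 4; 5; 6; 7; 8; 8; 11; 11; 16; 16; 17; 17; 28; 28; 30; 30];
  [:: 0; 1; 2; 3; 3; 3; 4; 5; 6; 8; 15; 15; 15; 16; 17; 17; 23; 24; 26; 26; 31];
  [:: 0; 1; 2; 3; 3; 4; 7; 7; 7; 8; 9; 10; 11; 16; 17; 22; 23; 24; 26; 29; 31];
  [:: 0; 1; 2; 3; 3; 4; 7; 7; 7; 8; 9; 12; 13; 16; 18; 21; 23; 24; 24; 25; 25];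
  [:: 0; 1; 2; 3; 3; 4; 7; 7; 7; 8; 11; 13; 14; 16; 16; 17; 17; 24; 24; 29; 29];
  [:: 0; 1; 2; 4; 7; 8; 11; 13; 13; 13; 14; 14; 14; 16; 16; 17; 17; 20; 20; 22; 22];
  [:: 1; 2; 3; 3; 3; 4; 5; 6; 7; 8; 8; 9; 9; 16; 16; 18; 18; 28; 28; 28; 28];
  [:: 1; 2; 3; 3; 3; 4; 5; 8; 9; 14; 14; 14; 14; 16; 17; 20; 20; 22; 22; 30; 31];
  [:: 1; 2; 3; 3; 4; 7; 7; 7; 7; 8; 9; 10; 12; 16; 17; 17; 23; 24; 26; 26; 31];
  [:: 1; 2; 3; 4; 5; 6; 7; 8; 8; 11; 11; 11; 11; 16; 16; 17; 17; 20; 20; 29; 29];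
  [:: 1; 2; 3; 4; 7; 8; 11; 13; 13; 13; 13; 14; 14; 16; 17; 20; 22; 25; 27; 28; 29];
  [:: 0; 1; 1; 2; 2; 4; 4; 6; 6; 8; 8; 11; 11; 16; 16; 19; 19; 28; 28; 29; 29];
  [:: 0; 1; 2; 3; 3; 4; 5; 5; 7; 8; 11; 13; 14; 16; 16; 21; 21; 25; 25; 26; 26];
  [:: 1; 2; 3; 3; 3; 4; 5; 6; 7; 8; 8; 9; 9; 16; 16; 17; 17; 28; 28; 31; 31];
  [:: 1; 2; 3; 3; 3; 4; 5; 5; 7; 8; 9; 9; 11; 16; 17; 17; 19; 29; 29; 29; 30];
  [:: 1; 2; 3; 3; 3; 4; 5; 6; 7; 8; 9; 10; 11; 16; 17; 18; 19; 28; 28; 31; 31];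
  [:: 0; 1; 2; 3; 3; 4; 5; 5; 7; 8; 9; 12; 13; 16; 18; 21; 23; 25; 25; 26; 26];
  [:: 1; 2; 3; 3; 3; 4; 7; 7; 7; 8; 9; 9; 11; 16; 17; 20; 22; 24; 26; 30; 31];
  [:: 1; 2; 3; 3; 4; 5; 5; 8; 12; 12; 15; 15; 15; 16; 17; 17; 20; 21; 22; 27; 28];
  [:: 1; 2; 3; 3; 4; 5; 7; 8; 13; 13; 13; 14; 14; 16; 17; 19; 20; 21; 22; 25; 28];
  [:: 1; 2; 3; 4; 5; 5; 7; 8; 9; 9; 11; 12; 12; 16; 19; 29; 29; 29; 30; 30; 30];
  [:: 0; 1; 2; 4; 7; 8; 10; 10; 11; 12; 12; 13; 14; 16; 16; 23; 23; 30; 30; 31; 31];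
  [:: 0; 1; 2; 4; 7; 8; 10; 10; 11; 12; 14; 14; 15; 16; 17; 18; 19; 27; 27; 28; 28];
  [:: 0; 1; 2; 4; 7; 8; 11; 13; 14; 16; 16; 23; 23; 26; 26; 28; 28; 30; 30; 31; 31];
  [:: 1; 2; 4; 7; 7; 8; 15; 15; 15; 16; 18; 18; 20; 20; 22; 22; 23; 24; 25; 26; 28];
  [:: 1; 2; 4; 7; 7; 8; 15; 15; 15; 16; 18; 18; 20; 21; 22; 22; 22; 24; 24; 27; 28];
  [:: 1; 2; 4; 7; 7; 8; 15; 15; 15; 16; 18; 19; 20; 21; 22; 22; 23; 24; 25; 27; 29];
  [:: 1; 2; 4; 8; 10; 10; 12; 12; 15; 16; 20; 21; 21; 21; 22; 27; 27; 27; 28; 28; 28];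
  [:: 1; 2; 4; 8; 10; 11; 12; 13; 15; 16; 20; 20; 20; 21; 22; 26; 26; 26; 29; 29; 29];
  [:: 1; 2; 4; 7; 7; 8; 15; 15; 15; 16; 19; 19; 21; 21; 22; 22; 23; 24; 25; 26; 28];
  [:: 1; 2; 4; 8; 15; 16; 17; 17; 17; 18; 18; 18; 20; 20; 20; 24; 24; 24; 31; 31; 31];
  [:: 1; 2; 3; 4; 5; 6; 6; 7; 7; 8; 9; 14; 14; 16; 17; 20; 20; 26; 26; 30; 31];
  [:: 1; 2; 3; 4; 5; 6; 7; 8; 8; 14; 14; 15; 15; 16; 16; 17; 17; 20; 20; 28; 28];
  [:: 1; 2; 3; 4; 5; 6; 7; 8; 9; 10; 11; 12; 12; 16; 17; 18; 19; 20; 20; 24; 24];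
  [:: 1; 2; 3; 3; 3; 4; 5; 6; 7; 8; 8; 9; 9; 16; 16; 20; 20; 25; 25; 31; 31];
  [:: 1; 2; 3; 3; 3; 4; 7; 8; 11; 12; 12; 13; 13; 16; 19; 24; 24; 25; 25; 29; 30];
  [:: 1; 2; 3; 3; 3; 4; 7; 8; 11; 12; 13; 14; 15; 16; 19; 20; 21; 22; 23; 29; 30];
  [:: 1; 2; 3; 4; 5; 6; 6; 7; 7; 8; 9; 14; 14; 16; 18; 20; 23; 25; 26; 28; 30];
  [:: 1; 2; 3; 4; 6; 6; 7; 8; 10; 10; 11; 13; 13; 16; 19; 20; 20; 22; 22; 29; 30]]%num.

Definition columns6 : seq (seq N) := [::
  [:: 0; 0; 0; 1; 2; 4; 7; 8; 11; 16; 19; 29; 29; 32; 37; 41; 47; 49; 55; 59; 62];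
  [:: 0; 1; 2; 4; 7; 8; 11; 13; 14; 16; 19; 21; 22; 32; 35; 37; 38; 57; 57; 57; 57];
  [:: 0; 0; 0; 1; 2; 4; 6; 8; 11; 16; 19; 28; 29; 32; 37; 40; 47; 49; 54; 58; 63];
  [:: 0; 0; 1; 2; 3; 4; 5; 8; 9; 16; 18; 29; 31; 32; 35; 44; 47; 52; 52; 58; 58];
  [:: 0; 0; 1; 2; 3; 4; 5; 8; 14; 16; 23; 25; 25; 32; 34; 40; 45; 50; 54; 61; 62];
  [:: 0; 1; 2; 3; 4; 5; 8; 9; 14; 16; 30; 30; 30; 32; 34; 36; 40; 49; 51; 53; 57];
  [:: 0; 1; 2; 3; 4; 5; 8; 14; 14; 16; 25; 25; 25; 32; 34; 36; 47; 49; 50; 52; 62];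
  [:: 1; 2; 3; 4; 5; 8; 9; 14; 14; 16; 18; 29; 31; 32; 35; 44; 47; 52; 52; 52; 52];
  [:: 1; 2; 3; 4; 5; 8; 14; 16; 23; 25; 25; 25; 25; 32; 34; 36; 39; 43; 45; 49; 54];
  [:: 0; 1; 2; 3; 4; 5; 6; 8; 15; 16; 17; 24; 25; 32; 38; 40; 46; 50; 50; 61; 61];
  [:: 1; 2; 3; 4; 5; 6; 8; 15; 15; 16; 31; 31; 31; 32; 33; 34; 44; 53; 54; 55; 59];
  [:: 1; 2; 3; 4; 5; 8; 14; 14; 14; 16; 23; 23; 23; 32; 34; 42; 47; 48; 52; 60; 63];
  [:: 1; 2; 3; 4; 5; 6; 7; 8; 9; 16; 17; 26; 26; 32; 33; 44; 44; 54; 54; 56; 57];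
  [:: 0; 1; 2; 3; 3; 4; 7; 8; 11; 16; 19; 29; 29; 32; 37; 41; 47; 50; 52; 56; 61];
  [:: 0; 1; 2; 3; 3; 4; 7; 8; 13; 16; 21; 27; 27; 32; 37; 41; 41; 52; 52; 59; 62];
  [:: 0; 1; 2; 4; 7; 8; 11; 13; 14; 16; 16; 19; 19; 32; 32; 37; 37; 57; 57; 63; 63];
  [:: 1; 2; 3; 4; 7; 7; 7; 8; 11; 16; 19; 25; 26; 32; 39; 41; 46; 49; 54; 59; 60];
  [:: 1; 2; 3; 4; 7; 7; 7; 8; 11; 16; 19; 29; 30; 32; 32; 41; 41; 49; 49; 60; 60];
  [:: 1; 2; 3; 4; 7; 7; 7; 8; 11; 16; 20; 25; 29; 32; 39; 42; 45; 49; 49; 56; 56];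
  [:: 0; 1; 2; 3; 3; 4; 5; 8; 10; 16; 22; 26; 28; 32; 36; 43; 47; 49; 49; 60; 60];
  [:: 0; 1; 2; 3; 3; 4; 5; 8; 13; 16; 23; 26; 26; 32; 33; 42; 44; 48; 52; 60; 63];
  [:: 0; 1; 2; 3; 4; 7; 7; 8; 9; 16; 18; 25; 30; 32; 33; 41; 45; 50; 53; 61; 63];
  [:: 0; 1; 2; 4; 5; 8; 10; 16; 17; 21; 22; 28; 30; 32; 32; 35; 35; 45; 45; 58; 58];
  [:: 1; 2; 3; 3; 4; 5; 8; 10; 13; 16; 29; 29; 29; 32; 33; 38; 42; 49; 51; 55; 56];
  [:: 1; 2; 3; 3; 4; 5; 8; 10; 13; 16; 29; 29; 29; 32; 37; 38; 46; 49; 55; 55; 60];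
  [:: 1; 2; 3; 3; 4; 5; 8; 13; 13; 16; 26; 26; 26; 32; 33; 37; 46; 48; 48; 54; 60];
  [:: 1; 2; 3; 4; 7; 7; 7; 8; 9; 16; 21; 25; 30; 32; 33; 41; 42; 50; 53; 56; 61];
  [:: 1; 2; 3; 3; 4; 5; 5; 8; 15; 16; 17; 24; 25; 32; 38; 43; 45; 49; 49; 62; 62];
  [:: 1; 2; 3; 3; 4; 5; 8; 13; 13; 16; 23; 23; 26; 32; 33; 39; 44; 52; 60; 61; 63];
  [:: 1; 2; 3; 3; 4; 8; 15; 16; 23; 24; 25; 26; 28; 32; 32; 37; 37; 47; 47; 49; 49];
  [:: 1; 2; 3; 4; 7; 7; 8; 9; 14; 16; 27; 28; 28; 32; 33; 38; 44; 48; 49; 50; 56];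
  [:: 1; 2; 3; 3; 4; 5; 7; 8; 13; 16; 19; 24; 27; 32; 38; 43; 45; 49; 49; 60; 60];
  [:: 1; 2; 3; 4; 7; 7; 8; 9; 11; 16; 25; 25; 30; 32; 33; 36; 43; 48; 52; 53; 63];
  [:: 1; 2; 3; 3; 4; 7; 8; 15; 15; 16; 17; 18; 27; 32; 33; 39; 46; 53; 56; 58; 63];
  [:: 1; 2; 3; 3; 4; 7; 8; 15; 15; 16; 17; 20; 29; 32; 33; 33; 40; 53; 56; 58; 63];
  [:: 1; 2; 3; 3; 4; 7; 8; 15; 15; 16; 27; 29; 30; 32; 33; 33; 40; 48; 53; 53; 56];
  [:: 1; 2; 3; 4; 7; 7; 8; 11; 12; 16; 17; 18; 24; 32; 33; 38; 44; 48; 57; 60; 62];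
  [:: 1; 2; 3; 4; 5; 6; 7; 8; 8; 16; 16; 27; 27; 32; 32; 41; 41; 52; 52; 62; 62];
  [:: 1; 2; 3; 4; 5; 6; 7; 8; 11; 16; 19; 24; 24; 32; 33; 44; 46; 52; 54; 56; 57];
  [:: 1; 2; 4; 6; 7; 8; 10; 11; 15; 16; 18; 24; 26; 32; 36; 43; 47; 50; 51; 52; 53];
  [:: 1; 2; 4; 8; 15; 16; 20; 21; 23; 24; 28; 29; 31; 32; 34; 36; 38; 54; 55; 56; 57]]%num.

Definition columns7 : seq (seq N) := [::
  [:: 0; 0; 1; 2; 4; 8; 14; 16; 23; 32; 39; 58; 59; 64; 75; 82; 95; 99; 110; 118; 125];
  [:: 0; 1; 2; 4; 7; 8; 11; 16; 19; 32; 37; 59; 62; 64; 70; 88; 94; 105; 105; 116; 116];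
  [:: 1; 2; 4; 7; 8; 11; 16; 19; 29; 32; 61; 61; 61; 64; 69; 73; 81; 99; 102; 106; 114];
  [:: 0; 1; 2; 4; 6; 8; 11; 16; 19; 32; 33; 60; 60; 64; 72; 86; 95; 102; 109; 115; 121];
  [:: 1; 2; 4; 6; 8; 11; 16; 19; 28; 32; 61; 61; 61; 64; 72; 79; 90; 98; 107; 108; 120];
  [:: 0; 1; 2; 4; 7; 8; 10; 16; 18; 32; 36; 59; 63; 64; 71; 89; 94; 104; 105; 116; 117];
  [:: 1; 2; 3; 4; 5; 8; 9; 16; 18; 32; 34; 61; 61; 64; 76; 84; 90; 103; 105; 114; 126];
  [:: 1; 2; 3; 4; 5; 8; 9; 16; 31; 32; 47; 50; 50; 64; 79; 84; 84; 104; 104; 113; 126];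
  [:: 1; 2; 3; 4; 5; 8; 16; 25; 25; 32; 34; 45; 54; 64; 67; 79; 85; 106; 115; 125; 125];
  [:: 1; 2; 3; 4; 5; 8; 14; 16; 23; 32; 40; 54; 62; 64; 79; 80; 95; 98; 98; 123; 123];
  [:: 1; 2; 3; 4; 5; 8; 14; 16; 25; 32; 46; 55; 55; 64; 66; 82; 94; 97; 106; 122; 127];
  [:: 1; 2; 4; 6; 8; 10; 12; 16; 31; 32; 35; 48; 51; 64; 77; 80; 93; 100; 101; 122; 123];
  [:: 1; 2; 4; 6; 7; 8; 10; 16; 20; 32; 45; 52; 57; 64; 72; 87; 95; 98; 99; 120; 121]]%num.

Definition columns8 : seq (seq N) := [::
  [:: 0; 1; 2; 4; 8; 16; 28; 32; 47; 64; 79; 117; 118; 128; 151; 165; 190; 198; 221; 236; 251];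
  [:: 1; 2; 4; 8; 14; 16; 23; 32; 39; 64; 65; 122; 122; 128; 146; 174; 189; 204; 217; 229; 241];
  [:: 1; 2; 4; 8; 12; 16; 23; 32; 38; 64; 67; 120; 121; 128; 144; 173; 191; 205; 218; 230; 243]]%num.

Definition columns9 : seq (seq N) := [::
  [:: 1; 2; 4; 8; 16; 32; 57; 64; 94; 128; 159; 234; 237; 256; 303; 331; 380; 396; 442; 473;
  503]]%num.

(** The lists for dimension k are parallel to its table, and each of them to the
    extensions of the corresponding entry.  The head of an item is the position of the
    class of the extension in the table of dimension k + 1, its tail is the list of the
    linear forms that carry the columns of the extension to those of that class. *)

Definition basis_changes0 : seq (seq (seq N)) := [::
  [:: [::0;1]; [::1;1]; [::2;1]]]%num.

Definition basis_changes1 : seq (seq (seq N)) := [::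
  [:: [::0;1;2]; [::1;1;3]; [::2;1;2]; [::3;1;3]; [::4;1;3]; [::5;1;3]];
  [:: [::6;1;2]; [::7;1;3]];
  [:: ]]%num.

Definition basis_changes2 : seq (seq (seq N)) := [::
  [:: [::0;1;2;4]; [::1;1;2;7]; [::2;1;2;4]; [::3;3;1;6]; [::3;5;1;6]; [::3;3;1;4]; [::3;1;2;5];
  [::4;3;5;7]; [::5;3;1;6]; [::5;5;1;2]; [::5;1;5;2]; [::5;3;1;4]; [::5;1;3;4]; [::6;1;3;4];
  [::7;1;2;7]; [::8;2;4;1]; [::9;3;1;6]; [::9;5;1;6]; [::9;3;1;4]; [::9;1;3;4]; [::10;3;5;7]];
  [:: [::11;1;3;5]; [::12;3;5;4]; [::12;1;7;4]; [::13;1;3;4]; [::14;1;6;5]; [::14;1;2;5];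
  [::15;7;1;5]; [::16;5;7;4]; [::16;3;5;4]; [::16;1;7;4]];
  [:: [::17;1;2;4]];
  [:: [::17;2;1;6]; [::18;1;2;5]; [::19;2;3;7]];
  [:: ];
  [:: ];
  [:: [::20;1;2;4]];
  [:: ]]%num.

Definition basis_changes3 : seq (seq (seq N)) := [::
  [:: [::0;1;2;4;8]; [::1;1;2;4;8]; [::2;7;1;2;12]; [::2;11;1;2;12]; [::2;7;1;2;8];
  [::2;3;1;4;10]; [::2;13;1;4;10]; [::2;7;1;2;14]; [::2;5;1;2;12]; [::2;11;1;2;14];
  [::2;3;1;4;8]; [::2;5;1;2;8]; [::2;9;1;2;12]; [::2;7;1;2;10]; [::2;1;2;4;9]; [::3;1;3;6;14];
  [::3;1;5;12;6]; [::3;1;3;10;6]; [::3;1;5;2;10]; [::3;1;5;10;2]; [::3;1;7;10;2];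
  [::3;1;3;6;10]; [::3;1;5;8;2]; [::3;3;5;8;2]; [::3;1;3;4;12]; [::3;1;3;10;4]; [::3;1;7;12;4];
  [::3;1;3;6;12]; [::3;1;3;8;4]; [::3;3;5;12;4]; [::3;1;3;6;8]; [::3;1;5;2;8]; [::3;1;3;4;8];
  [::3;3;5;2;8]; [::4;2;1;5;9]; [::4;4;1;3;9]; [::4;2;1;7;9]; [::5;3;1;4;14]; [::4;8;1;3;5];
  [::4;2;1;5;11]; [::4;4;1;3;13]; [::4;2;3;5;9]; [::5;3;1;8;14]; [::5;3;1;4;10]; [::5;1;5;2;10];
  [::5;5;1;8;14]; [::5;3;1;4;12]; [::5;1;3;4;12]; [::5;3;1;8;12]; [::5;3;1;4;8]; [::5;1;7;2;10];
  [::5;1;3;8;12]; [::5;1;5;2;8]; [::5;1;3;4;8]; [::6;3;1;4;14]; [::6;3;1;8;6]; [::6;1;9;2;6];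
  [::6;3;1;4;10]; [::6;5;1;8;2]; [::6;1;9;4;2]; [::6;1;5;2;10]; [::6;1;5;8;2]; [::6;1;13;4;2];
  [::6;3;1;4;12]; [::6;3;1;8;4]; [::6;1;9;2;4]; [::6;1;3;4;12]; [::6;1;3;8;4]; [::6;1;11;2;4];
  [::6;3;1;4;8]; [::6;1;5;2;8]; [::6;1;3;4;8]; [::6;1;7;2;8]; [::7;1;3;4;8]; [::8;3;5;9;1];
  [::8;5;7;9;1]; [::8;3;7;9;1]; [::8;1;3;5;9]; [::8;3;5;11;1]; [::8;1;3;9;5]; [::8;1;5;9;3];
  [::9;7;1;2;12]; [::9;11;1;2;12]; [::9;7;1;2;8]; [::9;3;1;4;10]; [::9;13;1;4;10];
  [::9;7;1;2;14]; [::9;5;1;2;12]; [::9;11;1;2;14]; [::9;3;1;4;8]; [::9;5;1;2;8]; [::9;9;1;2;12];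
  [::9;7;1;2;10]; [::9;1;3;4;8]; [::10;1;3;6;14]; [::10;1;5;12;6]; [::10;1;3;10;6];
  [::10;1;5;2;10]; [::10;1;5;10;2]; [::10;1;7;10;2]; [::10;1;3;6;10]; [::10;1;5;8;2];
  [::10;3;5;8;2]; [::10;1;3;4;12]; [::10;1;3;10;4]; [::10;1;7;12;4]; [::10;1;3;6;12];
  [::10;1;3;8;4]; [::10;3;5;12;4]; [::10;1;3;6;8]; [::10;1;5;2;8]; [::10;1;3;4;8];
  [::10;3;5;2;8]];
  [:: [::11;1;11;13;8]; [::12;3;8;9;13]; [::12;5;8;9;11]; [::12;1;8;11;13]; [::12;8;9;11;13];
  [::11;1;3;13;8]; [::11;1;5;11;8]; [::11;2;1;11;15]; [::13;2;12;9;1]; [::13;4;10;9;1];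
  [::13;2;14;9;1]; [::14;2;4;1;9]; [::13;2;4;1;9]; [::13;4;2;1;9]; [::13;2;6;1;9];
  [::15;3;13;9;8]; [::15;1;11;13;8]; [::15;1;13;11;8]; [::15;3;5;9;8]; [::15;1;3;13;8];
  [::15;1;5;11;8]; [::16;1;3;13;8]; [::17;6;10;9;1]; [::17;2;12;9;1]; [::17;4;10;9;1];
  [::18;10;4;9;1]; [::18;2;6;1;9]; [::18;4;2;1;9]; [::18;2;4;1;9]; [::17;2;4;1;9]];
  [:: [::19;1;2;4;8]; [::20;3;1;10;6]; [::20;3;1;6;10]; [::20;5;1;8;2]; [::20;1;5;8;2];
  [::21;3;4;6;15]; [::20;5;1;6;12]; [::20;3;1;8;4]; [::20;1;3;8;4]; [::20;3;1;4;8];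
  [::20;1;3;4;8]; [::22;1;3;4;8]];
  [:: [::23;1;2;4;8]; [::24;1;5;11;6]; [::24;1;7;9;10]; [::24;1;7;9;4]; [::24;3;5;11;4];
  [::24;1;5;11;8]; [::24;3;7;9;8]; [::25;3;1;10;4]; [::20;2;4;8;1]; [::25;3;1;6;8];
  [::26;3;5;1;8]; [::25;1;3;8;6]; [::20;2;6;10;1]; [::25;1;3;4;10]; [::27;5;3;2;8];
  [::27;1;11;2;4]; [::27;1;7;2;8]; [::27;5;15;2;4]; [::27;5;13;12;6]; [::27;5;15;12;4];
  [::28;3;1;4;8]; [::28;5;4;6;9]; [::29;1;3;4;8]; [::28;7;4;5;8]; [::28;1;3;4;8];
  [::30;4;13;5;6]; [::30;4;5;13;6]; [::31;4;1;9;6]; [::30;6;3;7;10]; [::31;6;1;5;10];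
  [::30;6;7;3;10]; [::30;6;13;7;4]; [::30;6;5;15;4]; [::31;6;3;9;4]; [::31;6;1;11;4];
  [::30;6;7;13;4]; [::30;6;15;5;4]; [::30;4;3;5;8]; [::31;4;3;5;8]; [::30;4;5;3;8];
  [::30;4;7;1;8]; [::31;4;1;7;8]; [::30;4;1;7;8]];
  [:: [::32;3;5;1;8]; [::33;1;8;3;5]; [::33;1;4;3;9]; [::33;1;2;5;9]; [::34;2;4;8;1];
  [::35;2;5;9;1]; [::35;4;3;9;1]; [::36;2;5;14;1]; [::35;8;3;5;1]; [::36;2;9;14;1];
  [::36;4;9;14;1]; [::37;3;5;8;1]];
  [:: [::38;1;3;4;8]];
  [:: [::38;2;5;1;14]; [::38;2;11;1;6]; [::38;2;3;9;6]; [::38;2;5;1;8]; [::38;1;2;5;8];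
  [::38;1;4;3;8]; [::38;2;3;7;8]; [::39;1;2;5;8]];
  [:: ];
  [:: ];
  [:: ];
  [:: ];
  [:: [::40;1;2;4;8]; [::41;3;9;8;6]; [::41;7;9;8;2]; [::41;3;13;8;2]; [::41;3;9;8;12];
  [::41;4;1;3;12]; [::41;1;11;8;12]; [::41;4;3;1;12]; [::42;1;3;4;8]];
  [:: ];
  [:: ];
  [:: ];
  [:: ];
  [:: ];
  [:: ];
  [:: ];
  [:: ];
  [:: ]]%num.

Definition basis_changes4 : seq (seq (seq N)) := [::
  [:: [::0;1;2;4;8;16]; [::1;2;1;5;9;16]; [::1;2;1;9;21;16]; [::1;2;1;5;25;16];
  [::1;2;5;9;17;16]; [::1;2;1;5;17;8]; [::1;2;1;13;17;8]; [::1;2;1;5;17;24]; [::1;2;1;13;17;24];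
  [::1;2;1;5;25;8]; [::1;2;5;9;17;8]; [::1;2;1;5;9;24]; [::1;2;1;9;21;24]; [::1;2;1;9;17;4];
  [::1;2;1;13;17;4]; [::1;2;1;9;17;20]; [::1;2;1;13;17;20]; [::1;2;1;9;21;4]; [::1;2;5;9;17;4];
  [::1;2;1;5;9;20]; [::1;2;1;5;25;20]; [::1;2;1;9;17;12]; [::1;2;1;5;17;12]; [::1;2;1;9;17;28];
  [::1;2;1;5;17;28]; [::1;2;1;9;21;12]; [::1;2;1;5;25;12]; [::1;2;1;5;9;28]; [::1;2;5;9;17;28];
  [::2;1;3;5;9;22]; [::2;1;5;9;15;28]; [::2;1;3;9;15;26]; [::2;1;3;5;15;22]; [::2;1;5;9;11;26];
  [::2;1;5;7;9;18]; [::2;1;7;9;11;26]; [::2;1;5;7;11;18]; [::2;1;3;9;13;26]; [::2;1;7;9;13;28];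
  [::2;1;3;7;9;20]; [::2;1;3;7;13;20]; [::2;1;3;5;9;16]; [::2;1;5;7;9;16]; [::2;1;3;7;9;16];
  [::2;3;5;7;9;16]; [::2;1;3;5;13;22]; [::2;1;5;11;13;28]; [::2;1;3;5;11;22];
  [::2;1;3;11;13;24]; [::2;1;3;5;9;18]; [::2;1;5;9;11;24]; [::2;1;3;5;11;18]; [::2;3;5;9;11;26];
  [::2;1;3;5;9;20]; [::2;1;3;9;13;24]; [::2;1;3;5;13;20]; [::2;3;5;9;13;28]; [::3;2;4;1;9;17];
  [::3;2;8;1;5;17]; [::3;2;4;1;13;17]; [::3;4;8;1;3;17]; [::3;2;4;1;11;17]; [::3;2;8;1;7;17];
  [::3;2;4;1;15;17]; [::3;2;16;1;5;9]; [::3;2;4;1;9;21]; [::3;2;8;1;5;25]; [::3;2;4;5;9;17];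
  [::3;4;16;1;3;9]; [::3;2;4;1;9;19]; [::3;4;8;1;3;25]; [::3;2;4;3;9;17]; [::3;2;16;1;7;9];
  [::3;2;4;1;9;23]; [::3;2;8;1;7;25]; [::3;2;4;7;9;17]; [::3;8;16;1;3;5]; [::3;2;8;1;5;19];
  [::3;4;8;1;3;21]; [::3;2;8;3;5;17]; [::3;2;16;1;5;11]; [::3;2;8;1;5;27]; [::3;2;4;1;11;21];
  [::3;2;4;5;11;17]; [::3;4;16;1;3;13]; [::3;2;4;1;13;19]; [::3;4;8;1;3;29]; [::3;2;4;3;13;17];
  [::3;2;16;3;5;9]; [::3;2;4;5;9;19]; [::3;2;4;3;9;21]; [::3;2;8;3;5;25]; [::4;3;5;9;1;16];
  [::4;3;9;5;1;16]; [::4;3;15;5;1;16]; [::4;1;7;3;17;8]; [::4;3;13;5;1;20]; [::4;5;7;9;1;16];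
  [::4;3;15;5;1;20]; [::4;1;3;5;17;8]; [::4;3;13;5;1;18]; [::4;3;9;5;1;18]; [::4;3;7;9;1;16];
  [::4;1;5;3;17;8]; [::4;1;7;3;9;16]; [::4;1;3;5;9;16]; [::4;1;5;3;9;16]; [::4;1;3;9;25;12];
  [::4;3;13;5;1;16]; [::4;3;5;9;1;18]; [::4;3;11;5;1;16]; [::4;1;7;3;17;10]; [::4;1;11;3;5;16];
  [::4;1;3;9;5;16]; [::4;1;9;3;5;16]; [::4;1;3;5;21;12]; [::4;1;13;5;3;16]; [::4;1;5;9;3;16];
  [::4;1;9;5;3;16]; [::4;1;5;3;19;10]; [::4;3;13;5;1;22]; [::4;1;7;3;9;18]; [::4;1;11;3;5;18];
  [::4;1;3;5;13;20]; [::4;1;13;5;3;20]; [::4;1;5;3;11;18]; [::4;1;9;3;7;18]; [::5;2;1;5;9;16];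
  [::5;2;1;9;21;16]; [::5;2;1;5;25;16]; [::5;2;5;9;17;16]; [::5;2;1;5;17;8]; [::5;2;1;13;17;8];
  [::5;2;1;5;17;24]; [::5;2;1;13;17;24]; [::5;2;1;5;25;8]; [::5;2;5;9;17;8]; [::5;2;1;5;9;24];
  [::5;2;1;9;21;24]; [::5;2;1;9;17;4]; [::5;2;1;13;17;4]; [::5;2;1;9;17;20]; [::5;2;1;13;17;20];
  [::5;2;1;9;21;4]; [::5;2;5;9;17;4]; [::5;2;1;5;9;20]; [::5;2;1;5;25;20]; [::5;2;1;9;17;12];
  [::5;2;1;5;17;12]; [::5;2;1;9;17;28]; [::5;2;1;5;17;28]; [::5;2;1;9;21;12]; [::5;2;1;5;25;12];
  [::5;2;1;5;9;28]; [::5;2;5;9;17;28]];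
  [:: [::6;7;1;2;20;14]; [::6;7;1;2;12;22]; [::6;3;1;8;18;6]; [::6;5;1;8;20;6];
  [::6;11;1;2;12;26]; [::6;3;1;4;18;10]; [::6;7;1;2;16;10]; [::6;3;1;4;10;18];
  [::6;3;7;10;18;2]; [::6;3;5;8;18;2]; [::6;7;1;2;8;18]; [::6;3;5;10;16;2]; [::6;1;5;8;16;2];
  [::6;13;1;4;10;28]; [::6;5;1;2;20;12]; [::6;7;1;2;22;12]; [::6;5;1;2;12;20]; [::6;3;1;8;16;4];
  [::6;5;3;8;20;4]; [::6;7;1;2;14;20]; [::6;5;3;10;22;4]; [::6;1;3;8;16;4]; [::6;9;1;2;12;24];
  [::6;3;1;4;16;8]; [::6;5;1;2;16;8]; [::6;11;1;2;14;24]; [::6;7;1;2;18;8]; [::6;1;3;4;16;8];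
  [::6;3;1;4;8;16]; [::6;5;1;2;8;16]; [::6;7;1;2;10;16]; [::6;1;3;4;8;16]; [::7;3;2;7;9;17];
  [::7;3;2;5;11;17]; [::7;5;4;3;13;17]; [::8;3;1;4;22;14]; [::7;3;2;5;9;19]; [::7;5;4;3;9;21];
  [::7;9;8;3;5;25]; [::7;1;2;5;9;17]; [::8;3;1;4;14;22]; [::8;3;1;8;18;6]; [::8;1;9;2;18;6];
  [::8;3;1;8;14;26]; [::8;3;1;4;18;10]; [::8;1;5;2;18;10]; [::8;3;1;4;10;18]; [::8;5;1;8;16;2];
  [::8;1;13;4;20;2]; [::8;1;5;2;10;18]; [::8;1;9;4;16;2]; [::8;1;5;8;16;2]; [::8;5;1;8;14;28];
  [::8;3;1;4;20;12]; [::8;1;3;4;20;12]; [::8;3;1;4;12;20]; [::8;3;1;8;16;4]; [::8;1;11;2;18;4];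
  [::8;1;3;4;12;20]; [::8;1;9;2;16;4]; [::8;1;3;8;16;4]; [::8;3;1;8;12;24]; [::8;3;1;4;16;8];
  [::8;1;7;2;18;8]; [::8;1;3;8;12;24]; [::8;1;5;2;16;8]; [::8;1;3;4;16;8]; [::8;3;1;4;8;16];
  [::8;1;7;2;10;16]; [::8;1;5;2;8;16]; [::8;1;3;4;8;16]; [::9;1;3;4;8;16]];
  [:: [::10;1;3;8;26;12]; [::10;1;3;6;10;18]; [::10;1;3;6;18;10]; [::6;2;4;8;16;1];
  [::10;1;3;4;22;12]; [::10;1;3;10;6;18]; [::10;1;3;4;14;20]; [::10;1;3;6;14;22];
  [::10;1;3;8;6;16]; [::10;1;3;6;22;14]; [::10;1;3;4;18;8]; [::6;2;6;10;16;1];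
  [::10;1;3;4;10;16]; [::10;1;3;10;26;14]; [::6;2;6;8;18;1]; [::6;2;4;10;18;1];
  [::11;3;5;9;1;16]; [::11;19;1;5;15;6]; [::11;11;1;5;9;24]; [::12;3;4;9;1;16];
  [::11;5;1;11;7;22]; [::11;5;1;9;7;20]; [::11;5;3;9;7;22]; [::11;7;1;9;5;20];
  [::12;3;6;11;1;16]; [::11;9;1;7;11;26]; [::12;3;6;9;1;18]; [::12;1;4;9;3;18];
  [::11;17;1;7;13;4]; [::11;1;7;9;3;18]; [::11;9;1;5;11;24]; [::11;9;3;5;11;26];
  [::11;17;1;5;13;6]; [::11;1;5;11;3;18]; [::11;17;3;5;13;4]; [::11;1;5;9;3;16];
  [::13;3;4;8;17;1]; [::14;3;4;8;17;1]; [::13;3;4;16;9;1]; [::13;3;8;12;25;1];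
  [::14;3;4;14;23;1]; [::14;3;8;12;25;1]; [::13;3;8;16;5;1]; [::13;3;4;12;21;1];
  [::13;3;4;20;13;1]; [::15;3;5;1;8;16]; [::13;1;4;10;17;3]; [::13;1;4;18;9;3];
  [::13;1;8;14;25;3]; [::14;3;8;14;27;1]; [::14;3;4;12;21;1]; [::13;1;8;18;5;3];
  [::13;1;4;14;21;3]; [::14;3;4;10;19;1]; [::13;1;4;22;13;3]; [::16;3;5;9;1;16];
  [::16;13;3;5;17;4]; [::16;3;5;11;1;18]; [::16;13;1;5;17;6]; [::16;11;3;5;9;26];
  [::16;11;1;5;9;24]; [::16;3;7;9;1;18]; [::16;13;1;7;17;4]; [::17;3;5;1;8;16];
  [::17;1;5;3;10;16]; [::16;11;1;7;9;26]; [::17;1;5;3;8;18]; [::16;5;1;9;7;20];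
  [::16;7;3;9;5;22]; [::16;7;1;9;5;20]; [::16;7;1;11;5;22]; [::17;1;7;3;10;18];
  [::16;9;1;5;11;24]; [::16;15;1;5;19;6]; [::16;1;5;9;3;16]];
  [:: [::18;3;5;1;8;16]; [::18;5;3;1;14;16]; [::18;21;5;4;6;30]; [::18;3;13;1;8;16];
  [::18;13;3;1;6;16]; [::18;19;3;26;24;22]; [::19;2;4;8;1;16]; [::19;2;12;22;17;16];
  [::19;2;4;30;17;16]; [::18;9;1;5;6;16]; [::18;1;8;4;2;17]; [::18;17;1;2;6;24];
  [::20;3;19;2;26;22]; [::20;5;11;9;17;16]; [::20;5;11;7;17;16]; [::20;3;19;2;26;30];
  [::20;3;5;1;9;16]; [::20;3;5;7;9;16]; [::21;3;5;1;8;16]; [::22;3;5;1;24;16];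
  [::22;5;3;1;8;16]; [::22;5;19;9;8;16]; [::23;3;5;1;8;16]; [::23;5;13;1;22;16];
  [::23;5;3;1;24;16]; [::23;5;11;7;22;16]; [::22;9;1;5;22;16]; [::22;7;1;5;14;16];
  [::22;7;17;11;14;16]; [::22;7;1;3;30;16]; [::22;1;9;5;6;16]; [::22;1;25;3;6;16];
  [::20;1;17;4;26;24]; [::20;1;9;5;19;16]; [::20;1;9;13;19;16]; [::24;2;5;9;1;16];
  [::24;2;5;1;9;16]; [::24;2;3;25;7;16]; [::25;2;4;9;17;1]; [::25;2;12;7;1;17];
  [::25;2;4;15;1;17]; [::26;2;5;9;1;16]; [::26;2;5;1;9;16]; [::26;4;3;25;1;16];
  [::27;3;5;1;8;16]; [::27;19;21;17;8;16]; [::27;5;27;1;22;16]; [::27;3;13;1;8;16];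
  [::27;19;29;17;8;16]; [::27;5;19;9;24;16]; [::28;3;5;8;1;16]; [::28;3;13;8;1;16];
  [::28;5;3;14;1;16]; [::28;19;11;22;17;16]; [::27;1;9;5;14;16]; [::27;17;25;21;14;16];
  [::27;1;25;3;22;16]; [::29;3;2;9;7;16]; [::26;12;1;3;5;16]; [::26;12;1;5;3;16];
  [::26;2;1;27;5;16]; [::26;4;1;3;13;16]; [::26;4;1;13;3;16]; [::26;2;9;19;5;16]];
  [:: [::30;1;2;4;8;16]; [::31;3;9;2;16;4]; [::30;1;2;8;4;16]; [::30;1;2;16;4;8];
  [::31;3;5;2;16;8]; [::31;3;5;2;8;16]; [::32;3;1;16;4;8]; [::32;3;1;8;4;16];
  [::33;29;3;4;8;16]; [::33;7;1;4;8;16]; [::33;13;11;4;8;16]; [::33;15;9;4;8;16];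
  [::33;5;3;4;8;16]; [::32;1;3;16;4;8]; [::32;1;3;8;4;16]; [::33;11;1;4;8;16];
  [::33;13;7;4;8;16]; [::33;19;1;4;8;16]; [::33;21;7;4;8;16]; [::32;3;1;4;8;16];
  [::32;1;3;4;8;16]; [::34;1;3;4;8;16]; [::33;15;5;4;8;16]; [::33;9;3;4;8;16];
  [::33;23;5;4;8;16]; [::33;17;3;4;8;16]];
  [:: [::35;2;1;24;11;5]; [::31;2;8;4;16;1]; [::35;2;1;24;19;5]; [::35;9;3;8;4;26];
  [::31;2;13;6;23;1]; [::31;10;3;14;25;1]; [::33;3;4;1;9;17]; [::36;3;5;1;8;16];
  [::33;13;4;1;7;17]; [::36;3;5;1;16;8]; [::36;3;11;17;14;24]; [::33;11;26;1;7;9];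
  [::33;5;4;7;9;17]; [::37;3;5;9;1;16]; [::37;9;1;3;5;16]; [::37;11;5;7;1;22];
  [::38;3;4;9;1;16]; [::37;1;17;3;11;6]; [::37;1;9;3;19;6]; [::37;1;25;11;3;14];
  [::39;2;5;9;17;1]; [::39;2;11;1;7;17]; [::36;9;1;4;16;30]; [::36;1;7;3;14;22];
  [::39;2;19;1;7;9]; [::36;1;7;3;22;14]; [::39;2;3;9;17;7]];
  [:: ];
  [:: ];
  [:: ];
  [:: ];
  [:: ];
  [:: [::40;2;4;8;16;1]; [::41;2;4;9;17;1]; [::40;10;3;25;15;1]; [::41;2;7;10;11;20];
  [::41;5;7;28;13;3]; [::40;6;3;21;15;1]; [::42;2;4;8;16;1]; [::43;3;5;9;1;16];
  [::44;3;5;9;1;16]; [::43;1;3;25;11;14]; [::44;9;3;21;17;16]; [::44;3;9;5;1;16];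
  [::43;1;3;21;7;14]; [::45;3;5;9;1;16]; [::44;21;9;19;1;16]; [::43;9;3;21;17;16];
  [::44;5;3;25;17;16]; [::44;25;5;19;1;16]; [::43;5;3;25;17;16]; [::43;17;5;9;13;14];
  [::46;3;5;8;17;1]; [::46;1;2;19;4;11]; [::44;2;1;11;24;15]; [::44;9;17;11;3;14];
  [::46;1;2;19;8;7]; [::44;2;1;7;20;15]; [::47;2;5;8;17;1]; [::46;9;3;4;1;17];
  [::44;20;1;7;2;15]; [::44;5;17;7;3;14]; [::46;5;3;8;1;17]; [::44;24;1;11;2;15];
  [::46;17;5;4;3;13]];
  [:: [::42;3;13;21;4;1]; [::48;3;5;9;1;16]; [::46;6;10;19;3;1]; [::46;10;6;19;3;1];
  [::46;12;6;21;5;1]; [::46;18;6;11;3;1]; [::46;20;6;13;5;1]; [::46;24;10;13;9;1];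
  [::49;3;5;9;17;1]];
  [:: [::50;2;5;9;1;16]; [::51;2;4;8;1;16]];
  [:: [::51;2;4;9;1;17]; [::51;4;2;9;1;17]; [::51;2;6;9;1;17]; [::52;2;4;1;8;17];
  [::50;2;20;17;8;1]; [::50;2;5;16;1;9]; [::50;2;12;9;8;25]; [::50;4;18;17;8;1];
  [::50;4;3;16;1;9]; [::50;4;10;9;8;25]; [::50;2;22;17;8;1]; [::50;2;7;16;1;9];
  [::50;2;14;9;8;25]];
  [:: ];
  [:: ];
  [:: ];
  [:: ];
  [:: ];
  [:: ];
  [:: ];
  [:: ];
  [:: [::30;1;9;20;17;18]; [::30;1;13;6;3;18]; [::40;8;13;14;15;28]; [::30;1;17;12;9;10];
  [::30;1;17;2;7;10]; [::30;1;21;6;3;10]; [::30;1;9;2;7;18]; [::40;10;22;23;21;6];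
  [::40;10;7;22;5;6]; [::40;8;4;25;13;2]; [::40;8;3;14;31;2]; [::40;8;4;17;5;2];
  [::40;8;1;4;21;2]; [::40;10;19;26;27;6]; [::40;10;3;26;11;6]; [::40;2;7;22;23;10];
  [::40;2;3;14;11;18]; [::40;2;7;14;15;18]; [::40;2;3;22;19;10]; [::35;3;6;1;8;20];
  [::35;3;6;1;16;12]; [::35;1;2;13;6;18]; [::35;1;2;21;6;10]; [::35;5;8;3;12;28];
  [::40;6;4;7;19;12]; [::40;6;4;23;3;12]; [::40;6;4;5;17;12]; [::40;6;4;21;1;12];
  [::40;6;4;5;9;20]; [::40;6;4;7;11;20]; [::35;5;16;3;20;28]; [::40;6;4;15;3;20];
  [::40;6;4;13;1;20]; [::40;2;4;21;5;8]; [::40;2;4;5;21;8]; [::40;2;4;23;7;8];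
  [::40;2;4;7;23;8]; [::35;3;8;19;12;10]; [::35;1;8;17;12;10]; [::40;2;3;4;19;8];
  [::40;2;4;19;3;8]; [::40;2;1;4;17;8]; [::40;2;4;17;1;8]; [::40;2;4;13;5;16];
  [::40;2;4;15;7;16]; [::40;2;3;4;11;16]; [::40;2;1;4;9;16]; [::35;3;16;11;20;18];
  [::35;1;16;9;20;18]; [::40;2;4;5;13;16]; [::40;2;4;7;15;16]; [::40;2;4;11;3;16];
  [::40;2;4;9;1;16]; [::53;5;17;16;6;12]; [::53;7;19;2;6;10]; [::54;5;17;18;30;28];
  [::53;3;1;20;10;6]; [::53;3;17;8;6;10]; [::53;3;1;12;18;6]; [::53;5;9;8;6;20];
  [::54;5;9;10;30;28]; [::53;7;11;2;6;18]; [::53;3;9;16;6;18]; [::53;3;17;12;2;10];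
  [::53;3;17;28;2;8]; [::53;3;19;6;2;10]; [::53;1;17;20;2;8]; [::54;3;1;8;14;18];
  [::54;1;17;18;26;28]; [::53;5;21;20;2;8]; [::53;7;23;6;2;10]; [::53;1;21;16;8;2];
  [::53;7;21;12;2;10]; [::54;3;1;10;22;16]; [::53;3;9;20;2;18]; [::53;3;11;6;2;18];
  [::53;5;13;12;2;16]; [::53;1;13;8;16;2]; [::53;3;9;28;2;16]; [::53;1;9;12;2;16];
  [::53;7;15;6;2;18]; [::53;7;13;20;2;18]; [::54;1;9;10;26;28]; [::53;5;3;2;20;8];
  [::53;7;1;2;20;8]; [::53;5;3;2;12;16]; [::53;7;1;2;12;16]; [::53;3;1;6;16;12];
  [::53;1;3;6;16;12]; [::53;3;1;6;8;20]; [::53;1;3;6;8;20]; [::54;9;1;2;4;20];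
  [::54;9;3;2;22;6]; [::54;17;1;2;4;12]; [::54;1;17;2;4;12]; [::54;17;3;2;14;6];
  [::54;1;19;2;14;6]; [::54;1;9;2;4;20]; [::54;1;11;2;22;6]; [::54;5;3;10;26;18];
  [::54;3;1;10;30;18]; [::54;1;3;10;30;18]; [::54;1;7;10;26;18]; [::54;3;1;8;4;16];
  [::54;3;17;16;24;20]; [::54;1;3;8;4;16]; [::54;1;19;16;24;20]; [::55;1;3;4;8;16];
  [::54;1;11;8;24;12]; [::54;1;7;12;4;20]; [::54;3;9;8;24;12]; [::54;3;5;12;4;20]];
  [:: [::56;1;5;9;2;28]; [::51;5;3;31;1;16]; [::51;2;11;7;1;16]; [::51;2;7;11;1;16];
  [::51;5;12;18;16;17]; [::57;2;19;24;1;6]; [::57;6;21;3;10;2]; [::57;6;5;19;10;2];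
  [::57;2;19;20;1;10]; [::57;10;25;3;6;2]; [::57;10;9;19;6;2]; [::50;1;5;21;6;12];
  [::50;2;21;5;6;12]; [::50;5;1;17;2;28]];
  [:: ];
  [:: ];
  [:: ];
  [:: ];
  [:: ];
  [:: ];
  [:: ];
  [:: ];
  [:: ];
  [:: ];
  [:: ];
  [:: ];
  [:: ];
  [:: ];
  [:: ];
  [:: ];
  [:: ];
  [:: ]]%num.

Definition basis_changes5 : seq (seq (seq N)) := [::
  [:: [::0;3;2;5;11;19;34]; [::0;13;4;1;7;17;32]; [::0;11;2;1;7;17;32]; [::0;5;2;1;9;17;32];
  [::0;3;2;5;11;17;32]; [::0;13;4;1;7;29;44]; [::0;7;2;1;11;17;32]; [::0;9;2;1;5;17;32];
  [::0;11;2;1;7;27;42]; [::0;5;2;1;9;21;36]; [::0;7;2;1;11;23;38]; [::0;9;2;1;5;25;40];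
  [::0;3;2;5;9;19;32]; [::0;11;2;1;5;19;32]; [::0;7;2;1;9;19;32]; [::0;13;4;1;7;25;40];
  [::0;11;2;1;5;27;40]; [::0;5;2;1;13;17;36]; [::0;7;2;1;15;19;38]; [::0;11;2;1;7;25;40];
  [::0;7;2;1;9;23;36]; [::0;7;2;1;15;17;36]; [::0;7;2;1;13;19;36]; [::0;7;2;1;11;21;36];
  [::0;13;4;1;7;21;36]; [::0;11;2;1;7;19;34]; [::0;7;2;1;11;19;34]; [::0;1;2;5;9;17;32];
  [::1;3;4;6;15;17;33]; [::1;3;4;6;9;23;33]; [::1;3;8;10;7;25;33]; [::1;3;8;10;5;27;33];
  [::1;3;4;6;11;21;33]; [::1;3;4;6;13;19;33]; [::1;5;8;12;3;29;33]; [::1;3;4;6;9;17;39];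
  [::1;3;8;10;7;17;41]; [::1;3;16;18;7;9;49]; [::1;1;2;4;9;17;33]; [::1;3;8;10;5;17;43];
  [::1;3;4;6;11;17;37]; [::1;3;16;18;5;11;49]; [::1;1;2;6;11;17;33]; [::1;3;4;6;13;17;35];
  [::1;5;8;12;3;17;45]; [::1;5;16;20;3;13;49]; [::1;1;4;6;13;17;33]; [::1;3;16;18;5;9;51];
  [::1;3;4;6;9;19;37]; [::1;3;8;10;5;19;41]; [::1;1;2;6;9;19;33]; [::1;3;4;6;9;21;35];
  [::1;5;16;20;3;9;53]; [::1;5;8;12;3;21;41]; [::1;1;4;6;9;21;33]; [::1;3;8;10;5;25;35];
  [::1;5;8;12;3;25;37]; [::1;9;16;24;3;5;57]; [::1;1;8;10;5;25;33]; [::1;1;2;6;9;17;35];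
  [::1;1;4;6;9;17;37]; [::1;1;8;10;5;17;41]; [::1;1;16;18;5;9;49]];
  [:: [::2;1;2;4;8;16;32]; [::2;1;2;4;16;8;32]; [::2;1;2;8;4;16;32]; [::2;1;2;8;16;4;32];
  [::2;1;2;16;4;8;32]; [::2;1;2;16;8;4;32]; [::3;2;4;9;16;33;1]; [::3;2;8;5;16;33;1];
  [::3;2;16;5;8;33;1]; [::4;1;6;4;49;15;22]; [::4;1;10;4;17;3;58]; [::4;1;6;4;41;23;14];
  [::4;1;10;6;17;3;34]; [::3;2;8;1;6;41;17]; [::3;2;16;1;6;49;9]; [::3;12;36;9;8;25;3];
  [::3;2;4;11;10;35;25]; [::4;1;6;4;37;21;14]; [::4;1;6;4;37;13;22]; [::3;2;4;1;10;37;17];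
  [::3;2;16;1;10;49;5]; [::3;12;36;5;6;21;1]; [::3;2;8;7;6;35;21]; [::3;2;4;1;18;37;9];
  [::3;2;8;1;18;41;5]; [::3;20;36;5;6;13;1]; [::3;2;16;7;6;35;13]; [::5;2;5;9;17;1;32];
  [::5;24;1;27;33;9;44]; [::5;20;1;23;33;5;44]; [::5;12;1;15;33;5;52]; [::6;1;4;8;17;3;44];
  [::6;1;16;18;49;21;26]; [::6;7;8;36;1;11;26]; [::6;5;6;48;1;11;34]; [::6;1;4;16;9;3;52];
  [::6;1;8;10;41;13;26]; [::6;7;16;36;1;19;26]; [::6;5;6;40;1;9;56]; [::5;2;7;9;17;1;56];
  [::5;24;3;25;33;9;46]; [::6;1;6;36;5;13;54]; [::6;1;4;6;37;13;22]; [::6;5;16;40;1;19;24];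
  [::6;5;8;48;1;11;24]; [::5;2;5;11;17;1;52]; [::5;20;3;21;33;5;46]; [::5;2;5;9;19;1;44];
  [::5;12;3;13;33;5;54]; [::6;1;6;10;19;3;46]; [::6;1;6;18;11;3;54]; [::6;1;4;36;7;13;52];
  [::7;2;4;9;16;33;1]; [::7;2;8;5;16;33;1]; [::7;2;16;5;8;33;1]; [::8;3;4;8;17;1;32];
  [::8;1;4;8;17;33;14]; [::8;3;4;16;9;1;32]; [::8;1;4;16;9;33;22]; [::7;12;36;9;8;25;3];
  [::7;2;4;11;10;35;25]; [::7;2;8;1;6;41;17]; [::7;2;16;1;6;49;9]; [::8;3;8;16;5;1;32];
  [::8;1;8;16;5;33;26]; [::7;12;36;5;6;21;1]; [::7;2;8;7;6;35;21]; [::7;2;4;1;10;37;17];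
  [::7;2;16;1;10;49;5]; [::7;20;36;5;6;13;1]; [::7;2;16;7;6;35;13]; [::7;2;4;1;18;37;9];
  [::7;2;8;1;18;41;5]; [::8;1;4;8;17;3;44]; [::8;1;4;16;9;3;52]; [::8;1;8;16;5;3;56];
  [::8;7;8;10;35;29;14]];
  [:: [::9;2;5;8;16;33;1]; [::9;2;15;4;16;1;33]; [::9;2;15;8;16;1;33]; [::9;1;2;11;21;17;37];
  [::9;1;2;7;25;17;41]; [::9;1;2;19;13;9;35]; [::9;1;4;7;25;17;41]; [::9;2;9;8;46;7;25];
  [::9;2;9;8;16;7;57]; [::9;1;2;19;13;5;35]; [::9;1;4;21;11;3;37]; [::9;2;5;4;46;11;21];
  [::9;2;5;4;16;11;53]; [::9;2;5;4;46;19;13]; [::9;2;5;4;16;51;13]; [::10;3;5;9;17;1;32];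
  [::10;3;9;5;17;1;32]; [::10;5;9;3;17;1;32]; [::10;3;5;17;49;1;30]; [::11;1;3;17;8;33;38];
  [::11;1;3;17;4;33;42]; [::10;7;43;13;1;5;20]; [::10;7;21;13;1;5;52]; [::11;1;3;9;4;25;42];
  [::11;1;3;9;4;57;42]; [::10;7;45;11;1;3;18]; [::10;7;19;11;1;3;50]; [::10;3;5;17;9;1;38];
  [::10;3;5;15;41;7;30]; [::11;2;7;19;23;48;30]; [::11;2;1;21;17;48;56]; [::11;1;3;5;8;21;38];
  [::11;1;3;5;8;53;38]; [::10;11;45;7;1;3;18]; [::10;11;19;7;1;3;50]; [::10;3;9;17;5;1;42];
  [::10;3;9;15;37;11;30]; [::11;2;11;19;27;48;30]; [::11;2;1;25;17;48;52]; [::10;5;9;17;3;1;44];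
  [::10;3;23;17;35;19;30]; [::11;2;1;33;17;4;12]; [::11;2;1;33;17;8;12]; [::10;19;45;7;1;3;10];
  [::10;7;21;1;13;5;38]; [::10;7;19;1;11;3;38]; [::10;11;19;1;7;3;42]];
  [:: [::12;2;5;8;17;1;32]; [::12;4;3;8;17;1;32]; [::12;2;7;8;17;1;32]; [::12;2;5;16;9;1;32];
  [::12;2;5;32;9;1;16]; [::12;4;3;16;9;1;32]; [::12;4;3;32;9;1;16]; [::12;2;7;16;9;1;32];
  [::12;2;7;32;9;1;16]];
  [:: ];
  [:: ];
  [:: [::13;3;4;9;17;1;32]; [::14;3;5;8;17;1;32]; [::14;3;11;6;17;1;32]; [::14;5;3;38;18;34;46];
  [::14;3;5;16;9;1;32]; [::14;3;19;6;9;1;32]; [::14;5;3;38;10;34;54]; [::14;11;3;40;26;34;38];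
  [::14;11;5;8;17;9;32]; [::14;11;3;14;17;9;32]; [::15;2;4;8;16;1;32]; [::15;2;4;14;22;1;32];
  [::15;2;8;12;24;32;1]; [::14;7;1;22;11;5;32]; [::14;7;17;6;11;5;32]; [::14;7;1;38;12;34;48];
  [::14;7;1;14;19;5;32]; [::14;7;9;6;19;5;32]; [::14;7;1;38;20;34;40]; [::14;9;1;40;4;34;56];
  [::14;1;17;8;5;3;32]; [::14;1;9;16;5;3;32]; [::16;3;5;1;8;16;32]; [::17;3;5;1;8;16;32];
  [::17;3;11;1;6;16;32]; [::17;3;19;1;6;8;32]; [::17;5;3;7;14;22;32]; [::18;3;5;17;40;48;32];
  [::18;5;13;1;6;16;32]; [::18;5;3;17;8;16;32]; [::18;3;5;9;48;40;32]; [::18;5;21;1;6;8;32];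
  [::18;5;3;9;16;8;32]; [::18;9;1;5;16;6;32]; [::18;9;25;3;8;6;32]; [::18;1;9;5;48;38;32]];
  [:: ];
  [:: ];
  [:: ];
  [:: [::19;1;16;28;4;53;3]; [::20;1;5;8;20;2;38]; [::19;1;40;10;2;27;5]; [::19;1;40;50;2;35;5];
  [::20;1;3;24;42;4;14]; [::14;11;4;8;1;16;41]; [::19;1;16;36;4;13;3]; [::14;11;2;14;1;40;17];
  [::21;3;5;1;8;16;32]; [::20;4;33;10;11;9;30]; [::19;1;42;8;2;13;17]; [::20;1;17;10;20;2;50];
  [::19;1;2;24;42;13;17]; [::19;3;1;54;32;40;16]; [::20;2;1;28;21;17;54];
  [::19;3;41;38;8;40;16]; [::20;4;9;36;35;33;48]; [::19;1;4;30;16;53;3]; [::22;2;4;8;16;32;1];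
  [::19;1;2;14;40;27;5]; [::19;1;2;54;40;35;5]; [::19;1;4;38;16;13;3]; [::14;11;16;10;3;4;41];
  [::23;3;4;9;17;1;32]; [::24;3;4;9;17;1;32]; [::25;2;5;8;17;1;32]; [::25;2;1;50;21;17;24];
  [::24;11;20;47;49;33;38]; [::24;13;2;7;33;9;30]; [::25;4;11;24;33;9;8];
  [::25;4;9;36;35;33;48]; [::24;5;42;25;57;17;24]; [::24;3;16;11;5;1;32]; [::23;3;16;11;5;1;32];
  [::24;5;40;29;3;1;8]; [::26;3;5;1;8;16;32]; [::23;5;40;37;3;1;48]; [::23;5;40;29;3;1;8];
  [::26;5;3;1;14;40;30]; [::23;3;16;51;5;1;24]; [::24;3;40;13;5;7;30]; [::24;5;16;27;3;7;54];
  [::24;17;42;31;3;1;10]; [::25;2;1;38;21;5;14]; [::24;9;20;47;37;33;36];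
  [::25;2;5;28;17;21;54]; [::25;4;11;50;33;35;38]; [::24;25;2;7;35;9;10];
  [::25;4;9;14;35;11;30]; [::24;1;42;25;19;17;28]; [::23;1;4;37;19;3;14]];
  [:: [::27;3;4;8;16;33;1]; [::27;19;4;48;16;9;17]; [::28;3;4;9;1;16;32]; [::29;2;4;8;16;32;1];
  [::27;19;8;48;16;5;17]; [::28;3;8;5;1;16;32]; [::28;19;48;21;17;16;24]; [::30;3;5;1;8;16;32];
  [::27;40;25;33;45;3;41]; [::29;2;8;4;16;32;1]; [::27;36;21;33;45;3;37]; [::29;2;48;4;16;24;1];
  [::27;15;4;8;46;19;13]];
  [:: [::28;19;21;25;8;9;56]; [::31;2;4;9;17;33;1]; [::28;19;27;23;6;7;54];
  [::28;3;5;41;48;33;32]; [::28;3;5;9;16;1;32]; [::31;2;4;33;1;9;17]; [::31;2;10;33;1;7;17];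
  [::28;19;35;15;6;7;22]; [::28;5;3;25;16;41;24]; [::30;6;8;17;1;5;36]; [::32;3;5;1;8;16;32];
  [::30;8;6;17;1;11;42]; [::32;13;5;1;6;48;32]; [::32;19;6;8;35;9;24]; [::32;19;3;9;6;8;56];
  [::30;48;6;1;9;13;28]; [::30;16;6;1;9;3;50]; [::32;17;1;5;8;6;54]; [::32;17;8;6;33;5;22];
  [::28;9;1;21;16;37;22]; [::28;17;33;13;8;11;24]; [::28;17;1;53;48;51;56];
  [::28;17;33;21;16;19;24]; [::28;1;9;37;48;35;32]; [::28;1;9;5;16;3;32]];
  [:: ];
  [:: ];
  [:: ];
  [:: ];
  [:: ];
  [:: [::27;11;8;9;24;34;4]; [::27;9;10;11;28;4;34]; [::28;19;25;20;12;8;54];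
  [::33;3;5;9;1;16;32]; [::34;3;5;9;1;16;32]; [::34;5;1;6;16;38;28]; [::35;3;5;9;1;16;32];
  [::35;5;3;9;33;48;32]; [::29;11;12;8;16;57;1]; [::35;13;8;1;40;25;19];
  [::35;11;10;34;28;24;17]; [::27;3;1;8;16;6;32]; [::27;35;8;33;54;6;32]; [::34;5;1;13;7;28;34];
  [::34;35;1;11;7;58;4]; [::33;3;35;11;1;48;6]; [::36;1;5;3;10;28;34]; [::33;11;41;1;9;24;4];
  [::33;11;15;3;9;28;34]; [::28;27;17;30;40;8;24]; [::28;25;17;26;12;10;58];
  [::35;33;1;9;5;16;6]; [::35;1;8;32;16;22;21]; [::34;33;1;4;24;38;16]; [::34;33;1;9;5;16;6];
  [::29;9;40;10;22;27;1]; [::35;9;8;4;24;58;49]; [::35;41;10;1;12;29;21];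
  [::34;39;5;6;22;38;28]; [::34;7;1;4;28;38;16]; [::27;1;3;10;48;32;6]; [::27;7;5;10;22;32;6];
  [::29;11;40;8;24;21;1]; [::29;9;12;10;28;53;1]; [::27;15;8;13;62;34;4];
  [::27;43;10;41;58;4;34]; [::28;17;25;18;40;10;22]];
  [:: [::37;2;4;8;1;16;32]; [::37;2;12;8;1;16;32]; [::38;2;4;8;1;17;32]; [::35;49;1;16;4;24;26];
  [::35;17;1;32;14;8;28]; [::35;49;1;16;20;24;42]; [::35;33;1;16;4;8;38];
  [::35;49;1;16;4;24;50]; [::35;49;1;16;20;24;2]; [::35;17;1;32;6;8;12]; [::35;33;1;16;4;8;14];
  [::35;1;17;32;6;8;12]; [::29;21;53;20;26;6;16]; [::29;5;37;4;2;14;16];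
  [::29;21;37;12;14;26;16]; [::29;21;37;4;6;26;16]; [::31;3;1;50;38;32;40];
  [::35;49;1;16;12;24;26]; [::35;17;1;32;6;8;20]; [::35;49;1;16;28;24;42];
  [::35;33;1;16;12;8;46]; [::29;35;3;2;4;46;48]; [::29;19;3;2;6;28;48]; [::31;5;1;20;38;32;8];
  [::31;5;9;28;6;32;8]; [::31;3;1;50;20;16;24]; [::29;23;7;6;2;12;32]; [::29;7;23;6;2;12;32];
  [::29;39;23;14;12;42;32]; [::29;39;23;6;4;42;32]; [::35;57;9;16;12;24;50];
  [::35;57;9;16;28;24;2]; [::35;25;9;32;14;8;4]; [::35;41;9;16;12;8;6]; [::35;9;25;32;14;8;4]];
  [:: ];
  [:: ];
  [:: ];
  [:: ];
  [:: ];
  [:: ];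
  [:: ];
  [:: ];
  [:: ];
  [:: ];
  [:: ];
  [:: ];
  [:: ];
  [:: ];
  [:: ];
  [:: [::39;1;2;4;8;16;32]];
  [:: ];
  [:: ];
  [:: ];
  [:: ];
  [:: ];
  [:: [::40;1;2;4;8;16;32]];
  [:: ];
  [:: ];
  [:: ];
  [:: ];
  [:: ];
  [:: ];
  [:: ];
  [:: ];
  [:: ];
  [:: ];
  [:: ];
  [:: ];
  [:: ];
  [:: ];
  [:: ];
  [:: ]]%num.

Definition basis_changes6 : seq (seq (seq N)) := [::
  [:: [::0;1;2;4;8;16;32;64]; [::0;1;2;4;8;32;16;64]; [::0;1;2;4;16;8;32;64];
  [::0;1;2;4;8;66;16;34]; [::0;1;2;4;16;66;32;10]; [::0;1;2;4;8;66;32;18];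
  [::1;3;4;8;17;32;65;1]; [::1;3;4;16;9;32;65;1]; [::1;3;4;32;9;16;65;1];
  [::1;1;4;8;19;66;33;3]; [::1;1;4;8;35;66;17;3]; [::1;3;10;12;27;42;75;1];
  [::1;3;4;12;21;36;69;1]; [::1;1;4;16;11;66;33;3]; [::1;1;4;12;39;70;21;3];
  [::1;3;10;12;27;72;41;1]; [::1;3;4;20;13;36;69;1]; [::1;1;4;20;15;70;37;3];
  [::1;1;4;12;23;70;37;3]; [::1;3;10;12;43;72;25;1]; [::1;3;4;36;13;20;69;1];
  [::2;3;4;9;17;33;1;64]; [::2;3;10;7;17;33;1;64]; [::2;3;18;7;9;33;1;64];
  [::2;3;34;7;9;17;1;64]; [::2;3;4;17;33;67;1;10]; [::2;1;18;5;11;65;3;34];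
  [::2;3;4;9;33;67;1;18]; [::2;1;10;5;19;65;3;34]; [::2;3;4;9;17;67;1;34];
  [::2;1;10;5;35;65;3;18]];
  [:: ];
  [:: [::0;4;15;1;13;44;28;64]; [::0;1;11;3;6;24;67;42]; [::0;1;35;3;38;49;98;10];
  [::0;1;13;8;25;32;72;11]; [::0;16;71;1;64;69;73;37]; [::0;2;1;4;8;16;32;64];
  [::3;2;4;9;17;33;1;64]; [::3;16;18;19;25;81;35;30]; [::3;16;18;3;5;83;49;30];
  [::3;2;6;9;17;3;35;66]; [::3;2;8;13;67;35;3;82]; [::3;2;6;15;83;3;33;66];
  [::3;2;10;13;67;1;33;80]; [::3;16;48;49;29;113;3;52]; [::3;2;4;13;81;33;3;64];
  [::3;18;20;11;3;81;19;50]; [::3;6;20;85;7;15;3;38]; [::3;20;24;25;53;93;7;28];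
  [::3;4;6;1;81;13;37;68]; [::3;4;8;11;69;45;5;28]; [::3;4;6;7;21;13;33;68];
  [::4;1;6;9;83;3;33;18]; [::4;1;2;17;59;51;97;38]; [::4;1;4;9;97;33;35;112];
  [::4;1;14;53;49;17;99;34]; [::4;1;2;19;25;49;65;4]; [::4;1;12;21;51;19;67;34];
  [::4;1;4;25;19;49;65;2]; [::4;1;8;13;67;35;3;82]; [::4;1;4;13;81;33;3;64];
  [::4;3;6;27;51;17;65;2]; [::4;1;6;9;29;5;41;92]; [::4;1;6;19;49;25;69;4];
  [::4;1;8;33;19;7;11;90]; [::4;1;8;21;31;59;71;14]; [::4;3;4;33;17;9;5;68];
  [::4;1;4;11;79;39;9;28]; [::4;1;2;5;53;37;43;114]; [::4;5;12;23;55;17;75;46];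
  [::4;1;2;11;25;41;5;64]; [::4;1;4;49;19;25;69;6]];
  [:: [::5;1;2;4;8;16;32;64]; [::6;3;4;9;17;33;1;64]; [::6;5;6;33;97;9;17;32];
  [::7;2;5;8;16;33;1;64]; [::7;2;69;72;80;65;97;64]; [::8;3;4;8;17;1;32;64];
  [::8;5;30;16;65;17;24;32]; [::8;11;36;40;1;49;32;64]; [::8;27;62;48;81;33;32;24];
  [::8;11;6;8;65;9;32;24]; [::8;3;36;16;9;1;32;64]; [::8;11;38;40;1;105;32;24];
  [::8;13;18;8;9;33;24;64]; [::7;20;16;19;48;1;64;25]; [::7;20;80;83;112;89;64;65];
  [::6;3;6;9;73;33;1;24]; [::7;2;16;23;80;17;24;49]; [::7;2;8;15;72;41;24;9]];
  [:: [::5;2;16;36;8;68;12;13]; [::5;1;2;24;33;15;120;41]; [::5;1;5;9;18;72;56;25];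
  [::5;1;5;9;48;68;26;17]; [::5;1;64;8;17;4;3;33]; [::9;2;5;8;16;32;65;1];
  [::10;3;5;9;16;33;1;64]; [::10;15;53;23;84;21;5;52]; [::10;7;73;5;96;81;65;64];
  [::10;7;53;47;36;37;5;116]; [::8;3;4;9;17;33;65;1]; [::8;3;72;69;17;97;65;1];
  [::10;1;21;33;24;65;17;22]; [::9;1;11;18;5;35;67;33]; [::8;1;4;33;9;65;7;17];
  [::9;1;15;38;5;23;7;81]; [::8;5;72;11;1;9;25;33]; [::10;9;75;17;2;69;3;98];
  [::10;1;7;37;70;13;3;22]; [::9;1;17;48;69;27;21;3]; [::8;9;72;33;1;5;81;11];
  [::9;1;33;48;5;35;101;11]; [::8;1;72;81;5;65;67;33]; [::10;5;79;33;10;9;11;26];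
  [::8;7;48;87;3;17;19;9]; [::8;7;48;23;67;29;19;5]; [::10;3;53;1;24;85;19;22];
  [::10;3;49;9;36;33;35;98]; [::8;17;72;9;3;41;13;1]; [::8;7;48;39;3;37;99;13]];
  [:: ];
  [:: ];
  [:: ];
  [:: ];
  [:: [::11;1;2;4;8;16;32;64]; [::11;5;1;21;85;11;32;12]; [::11;1;2;35;16;8;65;13]];
  [:: ];
  [:: ];
  [:: ];
  [:: ];
  [:: ];
  [:: ];
  [:: ];
  [:: ];
  [:: ];
  [:: [::12;1;2;4;8;16;32;64]];
  [:: [::12;2;72;112;4;20;28;13]; [::12;5;15;6;64;16;1;97]; [::12;2;28;9;112;65;69;100];
  [::12;3;9;16;46;6;7;103]];
  [:: [::12;3;11;7;16;70;44;10]; [::12;4;21;44;22;12;9;69]; [::12;7;86;69;33;36;59;54];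
  [::12;3;21;25;65;105;76;69]; [::12;8;32;64;47;9;25;3]; [::12;4;12;22;33;7;75;13];
  [::12;8;32;16;15;89;25;3]; [::12;4;1;32;76;12;29;11]; [::12;5;38;45;83;72;73;64];
  [::11;3;21;64;48;17;89;80]; [::12;3;51;19;65;69;96;105]; [::12;3;67;99;17;53;16;25];
  [::12;4;9;12;70;32;21;3]];
  [:: [::11;2;8;36;28;9;40;104]];
  [:: ];
  [:: ];
  [:: ];
  [:: ];
  [:: ];
  [:: ];
  [:: ];
  [:: ];
  [:: ];
  [:: ];
  [:: ];
  [:: ];
  [:: ];
  [:: ];
  [:: ];
  [:: ];
  [:: ];
  [:: ]]%num.

Definition basis_changes7 : seq (seq (seq N)) := [::
  [:: [::0;1;2;4;8;16;32;64;128]; [::0;1;6;4;20;132;12;64;36]; [::0;1;2;4;20;32;132;12;68];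
  [::0;1;6;4;8;32;64;132;20]; [::0;1;2;4;36;132;64;16;8]; [::1;2;5;8;17;33;65;1;128];
  [::1;2;13;128;193;5;33;131;148]; [::1;2;21;68;77;1;129;67;96]; [::1;2;9;36;49;1;129;35;96];
  [::1;2;5;36;133;65;17;1;8]; [::1;2;5;68;133;33;13;1;20]; [::1;2;1;20;37;129;9;5;68];
  [::1;2;5;8;65;133;17;1;36]; [::1;2;69;20;29;1;37;19;148]; [::1;2;33;8;25;5;65;11;136]];
  [:: ];
  [:: ];
  [:: [::2;1;2;4;8;16;32;64;128]; [::2;3;32;45;69;192;96;65;17]; [::2;1;32;5;13;64;128;17;67];
  [::2;1;4;2;64;144;32;8;128]];
  [:: ];
  [:: [::2;1;32;49;7;74;35;162;97]; [::2;1;3;21;135;139;129;162;67];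
  [::2;1;67;21;7;11;129;34;3]; [::2;5;3;9;31;151;53;86;131]; [::2;1;3;37;135;203;129;146;67];
  [::2;1;16;49;7;10;19;146;81]; [::2;3;67;102;12;11;73;25;129]; [::2;1;80;65;11;44;201;8;33]];
  [:: ];
  [:: ];
  [:: ];
  [:: ];
  [:: ];
  [:: ];
  [:: ]]%num.

Definition basis_changes8 : seq (seq (seq N)) := [::
  [:: [::0;1;2;4;8;16;32;64;128;256]; [::0;1;4;10;45;141;268;25;69;13];
  [::0;1;2;12;43;75;266;25;131;11]; [::0;1;2;4;22;14;38;68;130;262]];
  [:: ];
  [:: ]]%num.

Definition table k : seq (seq bitseq) :=
  [seq [seq num_bits k n | n <- s] | s <-
    nth [::] [:: columns0; columns1; columns2; columns3; columns4;
                 columns5; columns6; columns7; columns8; columns9] k].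

Definition basis_changes k : seq (seq (nat * seq bitseq)) :=
  [seq [seq (nat_of_bin (head 0%num t), [seq num_bits k.+1 n | n <- behead t]) | t <- ts]
  | ts <- nth [::] [:: basis_changes0; basis_changes1; basis_changes2; basis_changes3;
                       basis_changes4; basis_changes5; basis_changes6; basis_changes7;
                       basis_changes8] k].

(** Each table consists of generator matrices of codes of the right dimension and
    weights, no two of which are equivalent. *)
Lemma tables_irredundant :
  all (fun k => all (good_columns k) (table k) && distinct k (table k)) (iota 0 10).
Proof. by vm_compute. Qed.

(** Every extension of an entry is equivalent to an entry of the next table. *)
Lemma tables_closed :
  all (fun k => check_extensions k (table k) (table k.+1) (basis_changes k)) (iota 0 9).
Proof. by vm_compute. Qed.

Lemma size_table :
  [seq size (table k) | k <- iota 0 10] = [:: 1; 3; 8; 21; 43; 58; 41; 13; 3; 1].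
Proof. by vm_compute. Qed.

Theorem theorem1p8 (Z : finType) (hZ : #|Z| = 21) :
  [/\ r Z 1 = 1, r Z 2 = 3, r Z 3 = 13, r Z 4 = 41 & r Z 5 = 58] /\
  [/\ r Z 6 = 43, r Z 7 = 21, r Z 8 = 8, r Z 9 = 3 & r Z 10 = 1].
Proof.
have good k : k <= 9 -> all (good_columns k) (table k) && distinct k (table k).
  by move=> le_k9; apply: (allP tables_irredundant); rewrite mem_iota.
have complete k : k < 9 -> check_extensions k (table k) (table k.+1) (basis_changes k).
  by move=> lt_k9; apply: (allP tables_closed); rewrite mem_iota.
have rE k : k <= 9 -> r Z (10 - k) = nth 0 [:: 1; 3; 8; 21; 43; 58; 41; 13; 3; 1] k.
  move=> le_k9; have /andP[gk dk] := good k le_k9.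
  rewrite -size_table (nth_map 0) ?size_iota // nth_iota //.
  apply: count_classes => // [|E dE dimE]; first exact: leqW.
  apply: (classification hZ (n := 9) (bcs := basis_changes)) dE dimE => //.
  by move=> j /good/andP[].
by split; split; [exact: (rE 9)|exact: (rE 8)|exact: (rE 7)|exact: (rE 6)|exact: (rE 5)
                 |exact: (rE 4)|exact: (rE 3)|exact: (rE 2)|exact: (rE 1)|exact: (rE 0)].
Qed.
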